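(* Let $\mathrm{Top}$ be the category of pointed compactly generated spaces, and let $K$ be any set of cofibrant objects in $\mathrm{Top}$ that are small with respect to the cofibrations. Then $(\mathrm{Top},K)$ satisfies condition \$.
   Context: $\mathrm{Top}$ carries the Quillen model structure (weak homotopy equivalences, Serre fibrations), is closed symmetric monoidal under $\wedge$ with internal hom $\mathrm{Hom}$, and has generating trivial cofibrations $J=\{D^n_+\to(D^n\times[0,1])_+ : n\ge0\}$. A map $f$ is a $K$-colocal equivalence if $\mathrm{map}(A,f)$ is a weak equivalence for every $A\in K$, where $\mathrm{map}$ is the homotopy function complex; since $\mathrm{Top}$ is a topological model category in which every object is fibrant and the objects of $K$ are cofibrant, this may equivalently be tested with the topological mapping spaces $\mathrm{Hom}(A,f)$. Put $\Lambda(K)=\{A\wedge S^{n-1}_+\to A\wedge D^n_+ : A\in K,\ n\ge0\}$ (with $S^{-1}=\varnothing$). Condition \$: for every domain or codomain $A$ of a map in $\Lambda(K)\cup J$, the functor $\mathrm{Hom}(A,-):\mathrm{Top}\to\mathrm{Top}$ takes $K$-colocal equivalences between fibrant objects to $K$-colocal equivalences. *)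

(* Defs.v *)
From HB Require Import structures.
From mathcomp Require Import all_boot all_order all_algebra generic_quotient.
From mathcomp Require Import all_classical all_reals.
From mathcomp Require Import topology normedtype.

Set Implicit Arguments.
Unset Strict Implicit.
Unset Printing Implicit Defensive.

Import Order.TTheory GRing.Theory Num.Theory.
Import numFieldNormedType.Exports.

Local Open Scope classical_set_scope.
Local Open Scope ring_scope.

Definition test_map (C T : topologicalType) (f : C -> T) : Prop :=
  [/\ compact [set: C], hausdorff_space C & continuous f].

Definition compactly_open (T : topologicalType) (U : set T) : Prop :=
  forall (C : topologicalType) (f : C -> T), test_map f -> open (f @^-1` U).

Definition k_space (T : topologicalType) : Prop :=
  forall U : set T, compactly_open U -> open U.

Definition weak_hausdorff (T : topologicalType) : Prop :=
  forall (C : topologicalType) (f : C -> T), test_map f -> closed (range f).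

(* "Compactly generated" means weak Hausdorff k-space. *)
Record cgTop := CGTop {
  cg_space :> ptopologicalType;
  cg_k_space : k_space cg_space;
  cg_weak_hausdorff : weak_hausdorff cg_space }.

Record cgMap (X Y : cgTop) := CGMap {
  cg_fun :> X -> Y;
  cg_continuous : continuous cg_fun;
  cg_pointed : cg_fun point = point }.

HB.instance Definition _ (X Y : cgTop) := gen_eqMixin (cgMap X Y).
HB.instance Definition _ (X Y : cgTop) := gen_choiceMixin (cgMap X Y).

Lemma cgMap_eq (X Y : cgTop) (f g : cgMap X Y) : f =1 g -> f = g.
Proof.
case: f => f cf pf; case: g => g cg pg /= /funext e.
by case: _ / e in cg pg *; congr CGMap; exact: Prop_irrelevance.
Qed.

Definition kify (T : Type) : Type := T.

Section kification.
Context {T : topologicalType}.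

Lemma kopenT : compactly_open [set: T].
Proof. by move=> C f _; rewrite preimage_setT; exact: openT. Qed.

Lemma kopenI : setI_closed (@compactly_open T).
Proof.
by move=> A B oA oB C f tf; rewrite preimage_setI; apply: openI;
  [exact: oA | exact: oB].
Qed.

Lemma kopen_bigU (I : Type) (g : I -> set T) :
  (forall i, compactly_open (g i)) -> compactly_open (\bigcup_i g i).
Proof.
move=> og C f tf; rewrite preimage_bigcup; apply: bigcup_open => i _.
exact: og.
Qed.

HB.instance Definition _ := Choice.on (kify T).
HB.instance Definition _ :=
  isOpenTopological.Build (kify T) kopenT kopenI kopen_bigU.

Lemma kify_openE (U : set (kify T)) : open U = @compactly_open T U.
Proof. by []. Qed.

Lemma kify_id_continuous : continuous (id : kify T -> T).
Proof.
apply/continuousP => A oA; rewrite kify_openE => C f [_ _ /continuousP cf].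
exact: cf.
Qed.

Lemma test_map_kify (C : topologicalType) (f : C -> T) :
  test_map f -> test_map (f : C -> kify T).
Proof.
move=> tf; case: (tf) => cC hC cf; split => //.
by apply/continuousP => A; rewrite kify_openE; apply.
Qed.

Lemma kify_k_space : k_space (kify T).
Proof.
move=> U kU; rewrite kify_openE => C f tf; apply: kU; exact: test_map_kify.
Qed.

End kification.

HB.instance Definition _ (T : ptopologicalType) := Pointed.on (kify T).

Lemma k_space_continuous (S T : topologicalType) (f : S -> T) :
  k_space S ->
  (forall (C : topologicalType) (h : C -> S), test_map h -> continuous (f \o h)) ->
  continuous f.
Proof.
move=> kS cf; apply/continuousP => A oA; apply: kS => C h th.
by have /continuousP := cf _ _ th; apply.
Qed.

Lemma test_map_comp (C S T : topologicalType) (f : S -> T) (h : C -> S) :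
  continuous f -> test_map h -> test_map (f \o h).
Proof.
move=> cf [cC hC ch]; split => //.
by move=> x; apply: continuous_comp; [exact: ch|exact: cf].
Qed.

Lemma kify_continuous (S T : topologicalType) (f : S -> T) :
  continuous f -> continuous (f : kify S -> kify T).
Proof.
move=> cf; apply: k_space_continuous; first exact: kify_k_space.
move=> C h [cC hC ch].
suff: test_map ((f \o h) : C -> kify T) by case.
apply: test_map_kify; apply: test_map_comp => //; split => //.
move=> x; apply: (@continuous_comp C (kify S) S h id); first exact: ch.
exact: kify_id_continuous.
Qed.

Section weak_hausdorff_theory.

Lemma continuous_pair_comp (C D T : topologicalType) (f : C -> T) :
  continuous f -> continuous (fun z : C * D => f z.1).
Proof.
move=> cf z; apply: (@continuous_comp _ _ _ fst f); last exact: cf.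
exact: cvg_fst.
Qed.

Lemma set_type_compact (C : topologicalType) (A : set C) :
  compact A -> compact [set: set_type A].
Proof.
move=> cA; apply/compact_near_coveringP => I F P FF HP.
have : near_covering A by apply/compact_near_coveringP.
move=> /(_ I F (fun i x => forall a : set_type A, set_val a = x -> P i a) FF) H.
have : \forall i \near F, A `<=` (fun x => forall a : set_type A, set_val a = x -> P i a).
  apply: H => x Ax.
  have [[U V] /= [[U' [[W oW WU] U'x U'U]] FV] UVP] := HP (SigSub (mem_set Ax)) Logic.I.
  exists (W, V) => /=.
    split => //; apply: open_nbhs_nbhs; split => //.
    by move: U'x; rewrite -WU.
  move=> [y i] /= [Wy Vi] a ay; apply: (UVP (a, i)); split => //=.
  by apply: U'U; rewrite -WU /= ay.
by apply: filterS => i Pi [x Ax] _; apply: (Pi x) => //; exact: set_mem.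
Qed.

Lemma set_type_hausdorff (C : topologicalType) (A : set C) :
  hausdorff_space C -> hausdorff_space (set_type A).
Proof.
move=> hC x y clxy; apply: val_inj; apply: hC => U V Ux Vy.
have cv : continuous (set_val : set_type A -> C) by exact: initial_continuous.
have [z [Uz Vz]] := clxy _ _ (cv _ _ Ux) (cv _ _ Vy).
by exists (set_val z).
Qed.

Lemma set_val_continuous (C : topologicalType) (A : set C) :
  continuous (set_val : set_type A -> C).
Proof. exact: initial_continuous. Qed.

Lemma weak_hausdorff_image (C T : topologicalType) (f : C -> T) (A : set C) :
  weak_hausdorff T -> test_map f -> closed A -> closed (f @` A).
Proof.
move=> wT [cC hC cf] clA.
rewrite [X in closed X](_ : _ = range (f \o (set_val : set_type A -> C))).
  apply: wT; split; [|exact: set_type_hausdorff|].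
    by apply: set_type_compact; exact: subclosed_compact clA cC _.
  by move=> x; apply: continuous_comp; [exact: set_val_continuous|exact: cf].
apply/seteqP; split=> [_ [x Ax <-]|_ [x _ <-]].
  by exists (SigSub (mem_set Ax)).
by exists (set_val x) => //; exact: set_valP.
Qed.

Definition closed_equalizers (T : topologicalType) : Prop :=
  forall (C D : topologicalType) (f : C -> T) (g : D -> T),
    test_map f -> test_map g -> closed [set z : C * D | f z.1 = g z.2].

Lemma test_map_nbhs (C : topologicalType) (U : set C) (c : C) :
  compact [set: C] -> hausdorff_space C -> open U -> U c ->
  exists2 V, nbhs c V & closure V `<=` U.
Proof.
move=> cC hC oU Uc.
have := @compact_regular C c setT hC cC; rewrite /regular_space.
move=> /(_ filterT U (open_nbhs_nbhs (conj oU Uc))) [V cV VU].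
by exists V.
Qed.

Lemma unit_compact : compact [set: discrete_topology unit].
Proof.
rewrite (_ : setT = [set (tt : discrete_topology unit)]).
  exact: compact_set1.
by apply/seteqP; split => // -[].
Qed.

Lemma set1_closed (T : topologicalType) (x : T) :
  weak_hausdorff T -> closed [set x].
Proof.
move=> wT; rewrite (_ : [set x] = range (fun _ : discrete_topology unit => x)).
  apply: wT; split; last exact: cst_continuous.
  - exact: unit_compact.
  - exact: discrete_hausdorff.
by apply/seteqP; split=> [_ ->|_ [_ _ <-]//]; exists tt.
Qed.

Lemma weak_hausdorff_equalizers (T : topologicalType) :
  weak_hausdorff T -> closed_equalizers T.
Proof.
move=> wT C D f g tf tg; case: (tf) => cC hC cf; case: (tg) => cD hD cg.
rewrite -openC openE => -[c d] /= fg.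
have ofc : open (f @^-1` ~` [set g d]).
  move/continuousP: cf; apply; rewrite openC; exact: set1_closed.
have [V Vc VU] := test_map_nbhs cC hC ofc fg.
have clV := weak_hausdorff_image wT tf (@closed_closure _ V).
have ogd : open (g @^-1` ~` (f @` closure V)).
  by move/continuousP: cg; apply; rewrite openC.
exists (V, g @^-1` ~` (f @` closure V)) => /=.
  split => //; apply: open_nbhs_nbhs; split => // -[x /VU fx fxg].
  exact: fx.
move=> [c' d'] /= [Vc' nd'] e; apply: nd'; exists c' => //.
exact: subset_closure.
Qed.

Lemma equalizers_weak_hausdorff (T : topologicalType) :
  k_space T -> closed_equalizers T -> weak_hausdorff T.
Proof.
move=> kT eT C f tf; rewrite -openC; apply: kT => D g tg.
have := eT _ _ _ _ tf tg; set E := [set _ | _] => clE.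
case: (tf) => cC hC cf; case: (tg) => cD hD cg.
rewrite (_ : _ @^-1` _ = ~` (snd @` E)).
  rewrite openC; apply: compact_closed => //.
  apply: continuous_compact.
    by apply: continuous_subspaceT => z; exact: cvg_snd.
  apply: (subclosed_compact clE (compact_setX cC cD)).
  by move=> z _.
apply/seteqP; split=> d /=.
  by move=> nfd [[c d'] /= fg dd]; apply: nfd; exists c => //; rewrite fg dd.
by move=> nE [c _ fc]; apply: nE; exists (c, d).
Qed.

Lemma separated_weak_hausdorff (T : topologicalType) (J : Type)
    (Y : J -> topologicalType) (e : forall j, T -> Y j) :
  k_space T -> (forall j, weak_hausdorff (Y j)) ->
  (forall j, continuous (e j)) ->
  (forall x y, (forall j, e j x = e j y) -> x = y) ->
  weak_hausdorff T.
Proof.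
move=> kT wY ce se; apply: equalizers_weak_hausdorff => // C D f g tf tg.
rewrite (_ : mkset _ =
    \bigcap_j [set z : C * D | (e j \o f) z.1 = (e j \o g) z.2]).
  apply: closed_bigI => j _.
  by apply: weak_hausdorff_equalizers => //; exact: test_map_comp.
by apply/seteqP; split=> z /= fg;
  [move=> j _; rewrite /= fg|apply: se => j; exact: (fg j)].
Qed.

Lemma compact_hausdorff_k_space (T : topologicalType) :
  compact [set: T] -> hausdorff_space T -> k_space T.
Proof. by move=> cT hT U kU; apply: (kU T id); split => // x; exact. Qed.

Lemma hausdorff_weak_hausdorff (T : topologicalType) :
  hausdorff_space T -> weak_hausdorff T.
Proof.
move=> hT C f [cC hC cf]; apply: compact_closed => //.
by apply: continuous_compact => //; exact: continuous_subspaceT.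
Qed.

End weak_hausdorff_theory.

(* The compact-open topology as it is used for k-spaces: the test objects are
   maps h : C -> A out of compact Hausdorff spaces, not compact subsets of A. *)
Definition coMap (A X : cgTop) : Type := cgMap A X.

Section mapping_space.
Context (A X : cgTop).

Definition co_subbase : set (set (coMap A X)) :=
  [set W | exists (C : topologicalType) (h : C -> A) (U : set X),
    [/\ test_map h, open U & W = [set f : cgMap A X | forall c, U (f (h c))]]].

HB.instance Definition _ := Choice.on (coMap A X).
HB.instance Definition _ :=
  isSubBaseTopological.Build (coMap A X) co_subbase id.

Definition cst_cgMap : cgMap A X :=
  @CGMap A X (fun=> point) (@cst_continuous _ _ _) erefl.

HB.instance Definition _ := isPointed.Build (coMap A X) cst_cgMap.

Lemma co_subbase_open (W : set (coMap A X)) : co_subbase W -> open W.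
Proof.
move=> sW; exists [set W]; last by rewrite bigcup_set1.
by move=> _ ->; exact: (finI_from1 id sW).
Qed.

Lemma co_continuous (T : topologicalType) (F : T -> coMap A X) :
  (forall W, co_subbase W -> open (F @^-1` W)) -> continuous F.
Proof.
move=> oF; apply/continuousP => _ [D' D'D <-].
rewrite preimage_bigcup; apply: bigcup_open => V /D'D[E ED <-].
rewrite bigcap_fset big_seq.
elim/big_ind : _ => [|P Q oP oQ|W /ED].
- by rewrite preimage_setT; exact: openT.
- by rewrite preimage_setI; exact: openI.
- by move=> /set_mem; exact: oF.
Qed.

Lemma eval_continuous (a : A) : continuous (fun f : coMap A X => f a).
Proof.
apply/continuousP => U oU; apply: co_subbase_open.
exists (discrete_topology unit), (fun=> a), U; split => //.
  split; [exact: unit_compact|exact: discrete_hausdorff|exact: cst_continuous].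
by apply/seteqP; split=> f /= Uf; [move=> _|exact: (Uf tt)].
Qed.
End mapping_space.

Lemma hom_weak_hausdorff (A X : cgTop) : weak_hausdorff (kify (coMap A X)).
Proof.
apply: (@separated_weak_hausdorff _ A (fun=> X)
    (fun a => (fun f : cgMap A X => f a) : kify (coMap A X) -> X)).
- exact: kify_k_space.
- by move=> _; exact: cg_weak_hausdorff.
- move=> a f; exact: (@continuous_comp _ _ _ (id : kify (coMap A X) -> coMap A X)
    _ f (@kify_id_continuous _ f) (@eval_continuous A X a f)).
- by move=> f g /= fg; apply: cgMap_eq.
Qed.

Definition Hom (A X : cgTop) : cgTop :=
  @CGTop (kify (coMap A X)) kify_k_space (@hom_weak_hausdorff A X).

Section composition.
Context (X Y Z : cgTop) (g : cgMap Y Z) (f : cgMap X Y).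

Lemma cg_comp_continuous : continuous (g \o f).
Proof.
by move=> x; apply: continuous_comp; exact: cg_continuous.
Qed.

Lemma cg_comp_pointed : (g \o f) point = point.
Proof. by rewrite /= !cg_pointed. Qed.

Definition cg_comp : cgMap X Z := CGMap cg_comp_continuous cg_comp_pointed.
End composition.

Section postcomposition.
Context (A X Y : cgTop) (f : cgMap X Y).

Lemma Hom_map_continuous : continuous (cg_comp f : Hom A X -> Hom A Y).
Proof.
apply: (@kify_continuous (coMap A X) (coMap A Y)).
apply: co_continuous => _ [C [h [U [th oU ->]]]].
apply: co_subbase_open; exists C, h, (f @^-1` U); split => //.
by have /continuousP := @cg_continuous _ _ f; apply.
Qed.

Lemma Hom_map_pointed : cg_comp f (point : Hom A X) = (point : Hom A Y).
Proof. by apply: cgMap_eq => a /=; exact: cg_pointed. Qed.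

Definition Hom_map : cgMap (Hom A X) (Hom A Y) :=
  CGMap Hom_map_continuous Hom_map_pointed.
End postcomposition.

HB.instance Definition _ (T U : ptopologicalType) := Pointed.on (T * U)%type.

(* X /\ Y: the k-space product of X and Y with the wedge X \/ Y, the set of
   pairs having a coordinate at the base point, collapsed to a point. *)
Section smash.
Local Open Scope quotient_scope.
Context (X Y : cgTop).

Local Notation kprod := (kify (X * Y)%type).

Definition in_wedge (z : kprod) : bool := (z.1 == point) || (z.2 == point).

Definition smash_rel (z w : kprod) : bool :=
  (z == w) || (in_wedge z && in_wedge w).

Lemma smash_refl : reflexive smash_rel.
Proof. by move=> z; rewrite /smash_rel eqxx. Qed.

Lemma smash_sym : symmetric smash_rel.
Proof. by move=> z w; rewrite /smash_rel eq_sym andbC. Qed.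

Lemma smash_trans : transitive smash_rel.
Proof.
move=> w z v /orP[/eqP -> //|/andP[Wz Ww]] /orP[/eqP <-|/andP[_ Wv]].
  by rewrite /smash_rel Wz Ww orbT.
by rewrite /smash_rel Wz Wv orbT.
Qed.

Canonical smash_equiv := EquivRel smash_rel smash_refl smash_sym smash_trans.

Definition smash_space : Type := quotient_topology {eq_quot smash_equiv}.
HB.instance Definition _ := PointedTopological.on smash_space.
HB.instance Definition _ := Quotient.on smash_space.

Definition smash_pi (z : kprod) : smash_space := \pi_smash_space z.

Lemma smash_pi_continuous : continuous smash_pi.
Proof. exact: pi_continuous. Qed.

Lemma smash_piP (z w : kprod) : reflect (smash_pi z = smash_pi w) (smash_rel z w).
Proof. exact: (@eqmodP _ smash_equiv). Qed.

Lemma smash_openE (U : set smash_space) : open U = open (smash_pi @^-1` U).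
Proof. by []. Qed.

Lemma smash_k_space : k_space smash_space.
Proof.
move=> U kU; rewrite smash_openE; apply: kify_k_space => C f tf.
exact/(kU C (smash_pi \o f))/test_map_comp/tf/smash_pi_continuous.
Qed.

Lemma kprod_fst_continuous : continuous (fst : kprod -> X).
Proof.
move=> z; exact: (@continuous_comp _ _ _ (id : kprod -> (X * Y)%type) fst z
  (@kify_id_continuous _ z) cvg_fst).
Qed.

Lemma kprod_snd_continuous : continuous (snd : kprod -> Y).
Proof.
move=> z; exact: (@continuous_comp _ _ _ (id : kprod -> (X * Y)%type) snd z
  (@kify_id_continuous _ z) cvg_snd).
Qed.

Lemma kprod_weak_hausdorff : weak_hausdorff kprod.
Proof.
pose Z (b : bool) : topologicalType := if b then X else Y.
pose e (b : bool) : kprod -> Z b := if b return kprod -> Z b then fst else snd.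
apply: (@separated_weak_hausdorff _ bool Z e); first exact: kify_k_space.
- by case; exact: cg_weak_hausdorff.
- by case; [exact: kprod_fst_continuous|exact: kprod_snd_continuous].
- by move=> [x y] [x' y'] /= xy; congr (_, _); [exact: (xy true)|exact: (xy false)].
Qed.

Lemma wedge_closed : closed [set z : kprod | in_wedge z].
Proof.
rewrite (_ : mkset _ =
    (fst @^-1` [set point : X]) `|` (snd @^-1` [set point : Y])).
  apply: closedU.
    move/continuous_closedP: kprod_fst_continuous; apply.
    by apply: set1_closed; exact: cg_weak_hausdorff.
  move/continuous_closedP: kprod_snd_continuous; apply.
  by apply: set1_closed; exact: cg_weak_hausdorff.
apply/seteqP; split=> z /=; first by case/orP => /eqP; [left|right].
by case=> e; apply/orP; [left|right]; apply/eqP.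
Qed.

Lemma smash_repr (s : smash_space) : smash_pi (repr s) = s.
Proof. exact: reprK. Qed.

Lemma smash_point (z : kprod) : smash_pi z = point <-> in_wedge z.
Proof.
have W0 : in_wedge (point : kprod) by rewrite /in_wedge eqxx.
split=> [/smash_piP/orP[/eqP ->//|/andP[]//]|Wz].
by apply/smash_piP; rewrite /smash_rel Wz W0 orbT.
Qed.

Lemma smash_inj (z w : kprod) : ~ in_wedge z -> smash_pi z = smash_pi w -> z = w.
Proof. by move=> nz /smash_piP/orP[/eqP //|/andP[]]. Qed.

Lemma smash_set1_closed (s : smash_space) : closed [set s].
Proof.
rewrite -openC smash_openE -preimage_setC openC.
have [->|sp] := pselect (s = point).
  rewrite (_ : _ @^-1` _ = [set z : kprod | in_wedge z]).
    exact: wedge_closed.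
  by apply/seteqP; split => z; [exact: (smash_point z).1|exact: (smash_point z).2].
rewrite (_ : _ @^-1` _ = [set repr s]).
  exact/set1_closed/kprod_weak_hausdorff.
apply/seteqP; split=> z /=; last by move=> ->; exact: smash_repr.
move=> zs; apply: smash_inj; last by rewrite smash_repr.
by move=> /smash_point; rewrite zs.
Qed.

(* Away from the base point a test map lifts to the product. *)
Lemma smash_image_closed (C : topologicalType) (f : C -> smash_space) (A : set C) :
  test_map f -> closed A -> (forall c, A c -> f c <> point) -> closed (f @` A).
Proof.
move=> [cC hC cf] clA Af; rewrite -openC smash_openE -preimage_setC openC.
pose g : set_type A -> kprod := fun a => repr (f (set_val a)).
rewrite (_ : _ @^-1` _ = range g).
  apply: kprod_weak_hausdorff; split.
  - by apply: set_type_compact; exact: subclosed_compact clA cC _.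
  - exact: set_type_hausdorff.
  apply/continuousP => U oU.
  pose V : set smash_space := smash_pi @` (U `&` [set z | ~ in_wedge z]).
  have oV : open V.
    rewrite smash_openE (_ : _ @^-1` _ = U `&` ~` [set z | in_wedge z]).
      by apply: openI => //; rewrite openC; exact: wedge_closed.
    apply/seteqP; split=> [z [w [Uw nw]] /(smash_inj nw) <- //|z [Uz nz]].
    by exists z.
  rewrite (_ : _ @^-1` _ = set_val @^-1` (f @^-1` V)).
    have /continuousP := @set_val_continuous _ A; apply.
    by have /continuousP := cf; apply.
  apply/seteqP; split=> a /=.
    move=> Ua; exists (g a); last exact: smash_repr.
    split => //= /smash_point; rewrite smash_repr; apply: Af; exact: set_valP.
  case=> w [Uw nw] wa; rewrite /g -wa.
  by rewrite -(smash_inj nw (esym (smash_repr (smash_pi w)))).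
apply/seteqP; split=> [z [c Ac fc]|_ [a _ <-]].
  have nz : ~ in_wedge z by move=> /smash_point; rewrite -fc; exact: Af.
  exists (SigSub (mem_set Ac)) => //; rewrite /g /= fc.
  by apply: esym; apply: smash_inj => //; rewrite smash_repr.
by exists (set_val a); [exact: set_valP|rewrite /= smash_repr].
Qed.

Lemma smash_separate (C D : topologicalType) (f : C -> smash_space)
    (g : D -> smash_space) (c : C) (d : D) :
  test_map f -> test_map g -> f c <> g d -> f c <> point ->
  exists2 UV : set C * set D, nbhs c UV.1 /\ nbhs d UV.2 &
    forall c' d', UV.1 c' -> UV.2 d' -> f c' <> g d'.
Proof.
move=> tf tg fg fp; case: (tf) => cC hC cf; case: (tg) => cD hD cg.
have ofc : open (f @^-1` ~` ([set g d] `|` [set point])).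
  move/continuousP: cf; apply; rewrite openC.
  by apply: closedU; exact: smash_set1_closed.
have [|V Vc VU] := test_map_nbhs cC hC ofc (_ : _ c); first by case.
have clV : closed (f @` closure V).
  apply: smash_image_closed => //; first exact: closed_closure.
  by move=> c' /VU nc' e; apply: nc'; right.
have ogd : open (g @^-1` ~` (f @` closure V)).
  by move/continuousP: cg; apply; rewrite openC.
exists (V, g @^-1` ~` (f @` closure V)) => /=.
  split => //; apply: open_nbhs_nbhs; split => // -[x /VU fx fxg].
  by apply: fx; left.
by move=> c' d' Vc' nd' e; apply: nd'; exists c' => //; exact: subset_closure.
Qed.

Lemma smash_weak_hausdorff : weak_hausdorff smash_space.
Proof.
apply: equalizers_weak_hausdorff; first exact: smash_k_space.
move=> C D f g tf tg; rewrite -openC openE => -[c d] /= fg.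
have [fp|fp] := pselect (f c = point).
  have gp : g d <> point by rewrite -fp; exact: nesym.
  have [[U V] /= [Ud Vc] UV] := smash_separate tg tf (nesym fg) gp.
  by exists (V, U) => // -[c' d'] /= [Vc' Ud'] e; exact: (UV d' c').
have [[U V] /= [Uc Vd] UV] := smash_separate tf tg fg fp.
by exists (U, V) => // -[c' d'] /= [Uc' Vd']; exact: (UV c' d').
Qed.

Definition smash : cgTop := CGTop smash_k_space smash_weak_hausdorff.
End smash.

Section smash_map.
Local Open Scope quotient_scope.
Context (X Y X' Y' : cgTop) (f : cgMap X X') (g : cgMap Y Y').

Definition kprod_map (z : kify (X * Y)%type) : kify (X' * Y')%type := (f z.1, g z.2).

Lemma kprod_map_continuous : continuous kprod_map.
Proof.
apply: (@kify_continuous (X * Y)%type (X' * Y')%type (fun z => (f z.1, g z.2))).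
move=> z; apply: cvg_pair => /=.
  by apply: (@continuous_comp _ _ _ fst f z cvg_fst); exact: cg_continuous.
by apply: (@continuous_comp _ _ _ snd g z cvg_snd); exact: cg_continuous.
Qed.

Lemma kprod_map_rel (z w : kify (X * Y)%type) :
  smash_rel z w -> smash_rel (kprod_map z) (kprod_map w).
Proof.
have W v : in_wedge v -> in_wedge (kprod_map v).
  by case/orP => /eqP e; rewrite /in_wedge /= e cg_pointed eqxx ?orbT.
case/orP => [/eqP ->|/andP[/W Wz /W Ww]]; first by rewrite /smash_rel eqxx.
by rewrite /smash_rel Wz Ww orbT.
Qed.

Definition smash_fun (s : smash X Y) : smash X' Y' :=
  smash_pi (kprod_map (repr s)).

Lemma smash_fun_pi (x : X) (y : Y) :
  smash_fun (smash_pi (x, y)) = smash_pi (f x, g y).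
Proof.
apply/smash_piP; apply: (@kprod_map_rel _ (x, y)); apply/smash_piP; exact: reprK.
Qed.

Lemma smash_fun_continuous : continuous smash_fun.
Proof.
apply/quotient_continuous.
rewrite (_ : _ \o _ = @smash_pi X' Y' \o kprod_map).
  move=> z; apply: continuous_comp; first exact: kprod_map_continuous.
  exact: smash_pi_continuous.
by apply/funext => -[x y]; exact: smash_fun_pi.
Qed.

Lemma smash_fun_pointed : smash_fun point = point.
Proof.
by rewrite [LHS](smash_fun_pi point point) !cg_pointed.
Qed.

Definition smash_map : cgMap (smash X Y) (smash X' Y') :=
  CGMap smash_fun_continuous smash_fun_pointed.
End smash_map.

HB.instance Definition _ := isPointed.Build (discrete_topology unit) tt.

Definition cg_point : cgTop :=
  @CGTop (discrete_topology unit)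
    (compact_hausdorff_k_space unit_compact discrete_hausdorff)
    (hausdorff_weak_hausdorff discrete_hausdorff).

Record chTop := CHTop {
  ch_space :> topologicalType;
  ch_compact : compact [set: ch_space];
  ch_hausdorff : hausdorff_space ch_space }.

(* X_+, the topological sum of X and a base point. *)
Definition plus_space (X : Type) : Type := option X.

Section plus_topology.
Context (X : topologicalType).

Definition plus_open (U : set (plus_space X)) : Prop := open (Some @^-1` U).

Lemma plus_openT : plus_open setT.
Proof. by rewrite /plus_open preimage_setT; exact: openT. Qed.

Lemma plus_openI : setI_closed plus_open.
Proof. by move=> A B; exact: openI. Qed.

Lemma plus_open_bigU (I : Type) (g : I -> set (plus_space X)) :
  (forall i, plus_open (g i)) -> plus_open (\bigcup_i g i).
Proof.
move=> og; rewrite /plus_open preimage_bigcup; apply: bigcup_open => i _.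
exact: og.
Qed.

HB.instance Definition _ := Choice.on (plus_space X).
HB.instance Definition _ :=
  isOpenTopological.Build (plus_space X) plus_openT plus_openI plus_open_bigU.
HB.instance Definition _ := isPointed.Build (plus_space X) None.

Lemma Some_continuous : continuous (Some : X -> plus_space X).
Proof. by apply/continuousP. Qed.

Lemma plus_compact : compact [set: X] -> compact [set: plus_space X].
Proof.
move=> cX; rewrite (_ : setT = Some @` [set: X] `|` [set None]).
  apply: compactU; last exact: compact_set1.
  apply: continuous_compact => //; apply: continuous_subspaceT.
  exact: Some_continuous.
by apply/seteqP; split=> // -[x|] _; [left; exists x|right].
Qed.

Lemma plus_hausdorff : hausdorff_space X -> hausdorff_space (plus_space X).
Proof.
move=> hX.
have oN : nbhs (None : plus_space X) [set None].
  apply: open_nbhs_nbhs; split => //.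
  rewrite /open /= /plus_open (_ : _ @^-1` _ = set0); first exact: open0.
  by apply/seteqP; split.
have oS x : nbhs (Some x : plus_space X) (range Some).
  apply: open_nbhs_nbhs; split; last by exists x.
  rewrite /open /= /plus_open (_ : _ @^-1` _ = setT); first exact: openT.
  by apply/seteqP; split=> // z _; exists z.
move=> [x|] [y|] // clxy.
- congr Some; apply: hX => U V Ux Vy.
  have SU (W : set X) w : nbhs w W -> nbhs (Some w : plus_space X) (Some @` W).
    rewrite nbhsE => -[O [oO Ow] OW]; rewrite nbhsE; exists (Some @` O).
      split; last by exists w.
      rewrite /open /= /plus_open (_ : _ @^-1` _ = O) //.
      by apply/seteqP; split=> [z [z' Oz' [<-]]|z Oz]//; exists z.
    by move=> _ [z Oz <-]; exists z => //; exact: OW.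
  have [_ [[z Uz <-] [z' Vz' [zz']]]] := clxy _ _ (SU _ _ Ux) (SU _ _ Vy).
  by exists z; split => //; rewrite -zz'.
- by have [z [[w _ <-]]] := clxy _ _ (oS x) oN.
- by have [z [-> [w _]]] := clxy _ _ oN (oS y).
Qed.
End plus_topology.

Definition plus (X : chTop) : cgTop :=
  @CGTop (plus_space X)
    (compact_hausdorff_k_space (plus_compact (@ch_compact X))
       (plus_hausdorff (@ch_hausdorff X)))
    (hausdorff_weak_hausdorff (plus_hausdorff (@ch_hausdorff X))).

Section plus_map.
Context (X Y : chTop) (f : X -> Y) (cf : continuous f).

Lemma plus_continuous : continuous (omap f : plus X -> plus Y).
Proof.
apply/continuousP => U oU.
have /continuousP/(_ (Some @^-1` U) oU) := cf; exact.
Qed.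

Definition plus_map : cgMap (plus X) (plus Y) := CGMap plus_continuous erefl.
End plus_map.

Section discs.
Context (R : realType).

Definition disc_set (n : nat) : set 'rV[R]_n :=
  [set v | \sum_i v ord0 i ^+ 2 <= 1].

(* The sphere S^{n-1} in R^n; it is empty for n = 0. *)
Definition sphere_set (n : nat) : set 'rV[R]_n :=
  [set v | \sum_i v ord0 i ^+ 2 = 1].

Arguments disc_set n : clear implicits.
Arguments sphere_set n : clear implicits.

Lemma sqnorm_continuous (n : nat) :
  continuous (fun v : 'rV[R]_n => \sum_i v ord0 i ^+ 2).
Proof.
apply: (@continuous_big _ _ _ _ _ add_continuous) => i _ v.
have c := @coord_continuous R 1 n ord0 i v.
rewrite /continuous_at expr2; under eq_fun do rewrite expr2.
exact: (cvgM c c).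
Qed.

Lemma rV_hausdorff (n : nat) : hausdorff_space 'rV[R]_n.
Proof.
move=> v w clvw; apply/rowP => i; apply: (@Rhausdorff R) => U V Uv Vw.
have [z [Uz Vz]] := clvw _ _ (@coord_continuous R _ _ ord0 i v _ Uv)
                             (@coord_continuous R _ _ ord0 i w _ Vw).
by exists (z ord0 i).
Qed.

Lemma sub_disc_compact (n : nat) (A : set 'rV[R]_n) :
  closed A -> A `<=` disc_set n -> compact A.
Proof.
move=> clA AD; apply: (@subclosed_compact _ _
  [set v : 'rV[R]_n | forall i, `[(-1 : R), 1]%classic (v ord0 i)]) => //.
  by apply: (@rV_compact R n (fun=> `[(-1 : R), 1]%classic)) => i; exact: segment_compact.
move=> v /AD Dv i /=; rewrite in_itv /= -ler_norml -(@expr_le1 _ 2)//.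
rewrite real_normK ?num_real//; apply: le_trans Dv.
by rewrite (bigD1 i)//= lerDl; apply: sumr_ge0 => j _; exact: sqr_ge0.
Qed.

Lemma disc_compact (n : nat) : compact (disc_set n).
Proof.
apply: sub_disc_compact => //.
have /continuous_closedP/(_ _ (@closed_le R 1)) := @sqnorm_continuous n.
exact.
Qed.

Lemma sphere_compact (n : nat) : compact (sphere_set n).
Proof.
apply: sub_disc_compact; last by move=> v Sv; rewrite /disc_set /= Sv.
have /continuous_closedP/(_ _ (@closed_eq R 1)) := @sqnorm_continuous n.
exact.
Qed.

Definition subspace_ch (T : topologicalType) (A : set T) (cA : compact A)
    (hT : hausdorff_space T) : chTop :=
  @CHTop (set_type A) (set_type_compact cA) (set_type_hausdorff hT).

Definition disc (n : nat) : chTop :=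
  subspace_ch (@disc_compact n) (@rV_hausdorff n).

Definition sphere (n : nat) : chTop :=
  subspace_ch (@sphere_compact n) (@rV_hausdorff n).

Definition unit_interval : chTop :=
  subspace_ch (@segment_compact R 0 1) (@Rhausdorff R).

Lemma prod_hausdorff (S T : topologicalType) :
  hausdorff_space S -> hausdorff_space T -> hausdorff_space (S * T)%type.
Proof.
move=> hS hT [x y] [x' y'] clxy.
have f_cont : continuous (@fst S T) by move=> z; exact: cvg_fst.
have s_cont : continuous (@snd S T) by move=> z; exact: cvg_snd.
congr (_, _).
  apply: hS => U V Ux Vx'.
  have [z [Uz Vz]] := clxy _ _ (f_cont (x, y) _ Ux) (f_cont (x', y') _ Vx').
  by exists z.1.
apply: hT => U V Ux Vx'.
have [z [Uz Vz]] := clxy _ _ (s_cont (x, y) _ Ux) (s_cont (x', y') _ Vx').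
by exists z.2.
Qed.

Lemma prod_compact (S T : chTop) : compact [set: (S * T)%type].
Proof.
by rewrite -setXTT; apply: compact_setX; exact: ch_compact.
Qed.

Definition prod_ch (S T : chTop) : chTop :=
  CHTop (@prod_compact S T) (prod_hausdorff (@ch_hausdorff S) (@ch_hausdorff T)).

Definition cylinder (n : nat) : chTop := prod_ch (disc n) unit_interval.

Lemma zero_in_itv : (0 : R) \in `[0, 1]%classic.
Proof. by apply/mem_set; rewrite /= in_itv /= lexx ler01. Qed.

Lemma one_in_itv : (1 : R) \in `[0, 1]%classic.
Proof. by apply/mem_set; rewrite /= in_itv /= lexx ler01. Qed.

Definition itv0 : unit_interval := SigSub zero_in_itv.
Definition itv1 : unit_interval := SigSub one_in_itv.

Lemma sphere_mem_disc (n : nat) (v : sphere n) : set_val v \in disc_set n.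
Proof. by apply/mem_set; have /= Sv := set_valP v; rewrite /disc_set /= Sv. Qed.

Definition sphere_incl (n : nat) (v : sphere n) : disc n :=
  SigSub (sphere_mem_disc v).

Lemma sphere_incl_continuous (n : nat) : continuous (@sphere_incl n).
Proof.
apply/continuousP => _ [U oU <-].
by have /continuousP/(_ U oU) := @set_val_continuous _ (sphere_set n).
Qed.

Definition cylinder_incl (n : nat) (v : disc n) : cylinder n := (v, itv0).

Lemma cylinder_incl_continuous (n : nat) : continuous (@cylinder_incl n).
Proof.
move=> v U [[A B] /= [Av B0] AB]; apply: filterS Av => w Aw.
by apply: AB; split => //; exact: nbhs_singleton.
Qed.

(* Elements of pi_n(X, x) are represented by maps (D^n, S^{n-1}) -> (X, x) and
   are identified up to homotopy relative to S^{n-1}; pi_0(X, x) is the set of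
   path components of X. *)
Definition spheroid (X : topologicalType) (n : nat) (x : X) (a : disc n -> X) :
    Prop :=
  continuous a /\ forall v : sphere n, a (sphere_incl v) = x.

Definition rel_homotopic (X : topologicalType) (n : nat) (a b : disc n -> X) :
    Prop :=
  exists H : cylinder n -> X,
    [/\ continuous H, forall v, H (v, itv0) = a v, forall v, H (v, itv1) = b v &
        forall (v : sphere n) t, H (sphere_incl v, t) = a (sphere_incl v)].

Definition pi_surjective (X Y : topologicalType) (f : X -> Y) (n : nat) (x : X) :
    Prop :=
  forall b : disc n -> Y, spheroid (f x) b ->
    exists2 a : disc n -> X, spheroid x a & rel_homotopic (f \o a) b.

Definition pi_injective (X Y : topologicalType) (f : X -> Y) (n : nat) (x : X) :
    Prop :=
  forall a a' : disc n -> X, spheroid x a -> spheroid x a' ->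
    rel_homotopic (f \o a) (f \o a') -> rel_homotopic a a'.

(* No space is empty here, so quantifying over x loses nothing for n = 0. *)
Definition weak_equivalence (X Y : cgTop) (f : cgMap X Y) : Prop :=
  forall (n : nat) (x : X), pi_surjective f n x /\ pi_injective f n x.

Inductive J : forall X Y : cgTop, cgMap X Y -> Prop :=
  J_intro n : J (plus_map (@cylinder_incl_continuous n)).

Definition has_lifting (A B X Y : cgTop) (i : cgMap A B) (p : cgMap X Y) : Prop :=
  forall (u : cgMap A X) (v : cgMap B Y), cg_comp p u = cg_comp v i ->
    exists h : cgMap B X, cg_comp h i = u /\ cg_comp p h = v.

(* Serre fibrations; lifting pointed maps out of D^n_+ and (D^n x [0,1])_+ is
   lifting unpointed maps out of D^n and D^n x [0,1]. *)
Definition fibration (X Y : cgTop) (p : cgMap X Y) : Prop :=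
  forall (A B : cgTop) (i : cgMap A B), J i -> has_lifting i p.

Definition cofibration (A B : cgTop) (i : cgMap A B) : Prop :=
  forall (X Y : cgTop) (p : cgMap X Y),
    fibration p -> weak_equivalence p -> has_lifting i p.

Definition cofibrant (A : cgTop) : Prop := cofibration (cst_cgMap cg_point A).

Definition fibrant (X : cgTop) : Prop := fibration (cst_cgMap X cg_point).

Definition cg_id (X : cgTop) : cgMap X X :=
  @CGMap X X id (fun x => cvg_id) erefl.

Section colocal.
Context (I : Type) (K : I -> cgTop).

Inductive Lambda : forall X Y : cgTop, cgMap X Y -> Prop :=
  Lambda_intro i n :
    Lambda (smash_map (cg_id (K i)) (plus_map (@sphere_incl_continuous n))).

(* The homotopy function complex map(A, f) for A cofibrant: every object is
   fibrant, so it is modelled by the mapping space Hom(A, f). *)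
Definition colocal_equivalence (X Y : cgTop) (f : cgMap X Y) : Prop :=
  forall i, weak_equivalence (Hom_map (K i) f).

Definition condition_dollar : Prop :=
  forall (A B : cgTop) (m : cgMap A B), Lambda m \/ J m ->
  forall C : cgTop, C = A \/ C = B ->
  forall (X Y : cgTop) (f : cgMap X Y), fibrant X -> fibrant Y ->
    colocal_equivalence f -> colocal_equivalence (Hom_map C f).
End colocal.

End discs.

(* Diagrams indexed by a totally ordered set; ordinals are the well-founded
   ones. *)
Section smallness.
Context {d : Order.disp_t} (W : orderType d).

Record diagram := Diagram {
  dobj :> W -> cgTop;
  darr : forall a b : W, (a <= b)%O -> cgMap (dobj a) (dobj b);
  darr_id : forall a (aa : (a <= a)%O), darr aa = cg_id (dobj a);
  darr_comp : forall a b c (ab : (a <= b)%O) (bc : (b <= c)%O) (ac : (a <= c)%O),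
    darr ac = cg_comp (darr bc) (darr ab) }.

Context (X : diagram).

Definition cocone (P : set W) (L : cgTop) (l : forall a, P a -> cgMap (X a) L) :
    Prop :=
  forall a b (Pa : P a) (Pb : P b) (ab : (a <= b)%O),
    cg_comp (l b Pb) (darr X ab) = l a Pa.

Definition is_colimit (P : set W) (L : cgTop)
    (l : forall a, P a -> cgMap (X a) L) : Prop :=
  cocone l /\
  forall (Y : cgTop) (y : forall a, P a -> cgMap (X a) Y), cocone y ->
    exists! h : cgMap L Y, forall a (Pa : P a), cg_comp h (l a Pa) = y a Pa.

Definition successor (a b : W) : Prop :=
  (a < b)%O /\ forall c, (a < c)%O -> (b <= c)%O.

Definition limit_element (c : W) : Prop :=
  (exists a, (a < c)%O) /\
  forall a, (a < c)%O -> exists2 b, (a < b)%O & (b < c)%O.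

(* W is a kappa-filtered limit ordinal, kappa being the cardinality of T. *)
Definition filtered_ordinal (T : Type) : Prop :=
  [/\ well_founded (fun a b : W => (a < b)%O),
      forall a : W, exists b, (a < b)%O &
      forall S : set W, (S #<= [set: T])%card -> exists b, forall a, S a -> (a <= b)%O].

Definition transfinite_sequence
    (M : forall A B : cgTop, cgMap A B -> Prop) : Prop :=
  (forall a b (ab : (a <= b)%O), successor a b -> M _ _ (darr X ab)) /\
  (forall c, limit_element c ->
     @is_colimit [set a | (a < c)%O] (X c) (fun a ac => darr X (ltW ac))).

(* colim Top(A, X_a) -> Top(A, L) is a bijection. *)
Definition preserves_colimit (A L : cgTop)
    (l : forall a, [set: W] a -> cgMap (X a) L) : Prop :=
  (forall f : cgMap A L,
     exists a (Wa : [set: W] a) (g : cgMap A (X a)), cg_comp (l a Wa) g = f) /\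
  (forall a a' (Wa : [set: W] a) (Wa' : [set: W] a')
     (g : cgMap A (X a)) (g' : cgMap A (X a')),
     cg_comp (l a Wa) g = cg_comp (l a' Wa') g' ->
     exists b (ab : (a <= b)%O) (a'b : (a' <= b)%O),
       cg_comp (darr X ab) g = cg_comp (darr X a'b) g').
End smallness.

(* The cardinal kappa is that of an ordered type, so that it ranges over the
   same universe as the ordinals W. *)
Definition small_wrt (M : forall A B : cgTop, cgMap A B -> Prop) (A : cgTop) :
    Prop :=
  exists (d : Order.disp_t) (kappa : orderType d),
  forall (d' : Order.disp_t) (W : orderType d'), filtered_ordinal W kappa ->
  forall X : diagram W, transfinite_sequence X M ->
  forall (L : cgTop) (l : forall a, [set: W] a -> cgMap (X a) L),
    is_colimit l -> preserves_colimit A l.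

(* Main.v *)
From HB Require Import structures.
Require Import Defs.
From mathcomp Require Import all_boot all_order all_algebra.
From mathcomp Require Import all_classical all_reals topology normedtype realfun.
From mathcomp Require Import ring lra.

Set Implicit Arguments.
Unset Strict Implicit.
Unset Printing Implicit Defensive.

Import Order.TTheory GRing.Theory Num.Theory.
Import numFieldNormedType.Exports.
Import Defs.

Local Open Scope classical_set_scope.
Local Open Scope ring_scope.

(** Exchanging variables identifies [Hom(K_i, Hom(C, f))] with
[Hom(C, Hom(K_i, f))] ([hom_swap]), and [Hom(K_i, f)] is a weak equivalence by
hypothesis. So the claim is that [Hom(C, -)] preserves weak equivalences when [C]
is one of [K_i /\ S^(n-1)_+], [K_i /\ D^n_+], [D^n_+], [(D^n * [0,1])_+]. All of
these are cofibrant and all spaces are fibrant, which makes this an instance of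
Ken Brown's lemma; here it is proved in the following form.

A map is called acyclic if it has the right lifting property against the
inclusions of spheres into discs. For a weak equivalence [g : X -> Y], let [N] be
the space of points of [X] with a path in [Y] starting at their image, and
[N -> Y] the map to the end of the path.

- The end map [N -> Y] is acyclic ([path_end_acyclic]). Written out, this is the
  homotopy extension and lifting property of [g] for discs
  ([homotopy_extension_lifting]), which is deduced from bijectivity on homotopy
  groups: injectivity one dimension below extends a map from the sphere to the
  disc ([extension_over_disc]), and surjectivity corrects the homotopy class of
  the extension.
- If [p] is acyclic and [A] has the left lifting property against acyclic maps,
  then [Hom(A, p)] is acyclic ([hom_acyclic]). By adjunction a lifting problem
  for [Hom(A, p)] on [D^n] is one for [A] against the corner map of [p] and
  [S^(n-1) -> D^n]; the corner map is acyclic since [D^l * D^n] with its boundary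
  is again a disc with its boundary ([corner_map_acyclic]).
- Conversely, if a map factors through an acyclic map by a deformation section,
  it is a weak equivalence ([weak_equivalence_factor]). Since [Hom(A, N)] stands to
  [Hom(A, g)] as [N] stands to [g], this shows that [Hom(A, g)] is a weak
  equivalence ([hom_weak_equivalence]).

It remains that the four kinds of [C] have the left lifting property against
acyclic maps. For [K_i] this is cofibrancy, because an acyclic map is a Serre
fibration ([acyclic_fibration]) and a weak equivalence; spheres, discs and
cylinders are obtained by attaching cells; and a smash product inherits the
property from its factors by adjunction and the second item.

The point-set part rests on one principle: spaces are compactly generated, so
continuity of a map into a mapping space can be tested along maps from compact
Hausdorff spaces, where it is joint continuity ([hom_continuousP],
[eval_test_continuous]). *)

(** * Continuity by pieces *)

Section relative_continuity.

Lemma comp_continuous (S T U : topologicalType) (f : S -> T) (g : T -> U) :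
  continuous f -> continuous g -> continuous (fun x => g (f x)).
Proof. by move=> cf cg x; apply: (@continuous_comp _ _ _ f g); [exact: cf|exact: cg]. Qed.

Lemma pair_continuous (S T U : topologicalType) (f : S -> T) (g : S -> U) :
  continuous f -> continuous g -> continuous (fun x => (f x, g x)).
Proof. by move=> cf cg x; apply: cvg_pair; [exact: cf|exact: cg]. Qed.

Lemma fst_continuous (S T : topologicalType) : continuous (@fst S T).
Proof. by move=> z; exact: cvg_fst. Qed.

Lemma snd_continuous (S T : topologicalType) : continuous (@snd S T).
Proof. by move=> z; exact: cvg_snd. Qed.

Lemma idfun_continuous (T : topologicalType) : continuous (fun x : T => x).
Proof. by move=> x; exact: cvg_id. Qed.

Lemma within_comp (S T U : topologicalType) (f : S -> T) (g : T -> U)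
    (A : set T) (B : set S) :
  {within B, continuous f} -> (forall x, B x -> A (f x)) ->
  {within A, continuous g} -> {within B, continuous (fun x => g (f x))}.
Proof.
move=> /subspace_continuousP cf BA /subspace_continuousP cg.
apply/subspace_continuousP => x Bx V /(cg _ (BA _ Bx)) /= gV.
have := cf _ Bx _ gV; rewrite /nbhs /= /within /= => h.
by apply: filterS h => y /= h By; exact: h By (BA _ By).
Qed.

Lemma within_eq (S T : topologicalType) (f g : S -> T) (A : set S) :
  {within A, continuous f} -> (forall x, A x -> f x = g x) ->
  {within A, continuous g}.
Proof.
by move=> cf fg; apply: subspace_eq_continuous cf => x /set_mem; exact: fg.
Qed.

Lemma continuous_glue (S T : topologicalType) (f : S -> T) (A B : set S) :
  closed A -> closed B -> {within A, continuous f} -> {within B, continuous f} ->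
  (forall x, A x \/ B x) -> continuous f.
Proof.
move=> cA cB fA fB AB; apply/continuous_subspace_setT.
rewrite (_ : setT = A `|` B); first exact: withinU_continuous.
by apply/esym/seteqP; split => // x _; exact: AB.
Qed.

Lemma within_if (R : realType) (S T : topologicalType) (D : set S) (r : S -> R)
    (c : R) (f g : S -> T) :
  closed D -> continuous r ->
  {within D `&` [set x | r x <= c], continuous f} ->
  {within D `&` [set x | c <= r x], continuous g} ->
  (forall x, D x -> r x = c -> f x = g x) ->
  {within D, continuous (fun x => if r x <= c then f x else g x)}.
Proof.
move=> cD cr cf cg fg.
have -> : D = D `&` [set x | r x <= c] `|` D `&` [set x | c <= r x].
  apply/seteqP; split => [x Dx|x [] []//].
  by case: (leP (r x) c) => h; [left|right]; split => //=; exact: ltW.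
apply: withinU_continuous.
- apply: closedI => //.
  by move/continuous_closedP : cr => /(_ _ (@closed_le R c)).
- apply: closedI => //.
  by move/continuous_closedP : cr => /(_ _ (@closed_ge R c)).
- by apply: within_eq cf _ => x [_ /= ->].
- apply: within_eq cg _ => x [Dx /= cx]; case: ifPn => // xc.
  by apply/esym/fg => //; apply/eqP; rewrite eq_le xc.
Qed.

Lemma continuous_if (R : realType) (S T : topologicalType) (r : S -> R)
    (c : R) (f g : S -> T) :
  continuous r ->
  {within [set x | r x <= c], continuous f} ->
  {within [set x | c <= r x], continuous g} ->
  (forall x, r x = c -> f x = g x) ->
  continuous (fun x => if r x <= c then f x else g x).
Proof.
move=> cr cf cg fg; apply/continuous_subspace_setT; apply: within_if => //.
- by rewrite setTI.
- by rewrite setTI.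
- by move=> x _; exact: fg.
Qed.

(** Away from [Q] the glued map is [k] transported along the surjection from [C]
onto its closed image; a map out of a compact space into a Hausdorff one is
closed, hence a quotient map onto its image. *)
Lemma compact_glue (C P X : topologicalType) (phi : C -> P) (Q : set P)
    (u : P -> X) (k : C -> X) :
  compact [set: C] -> hausdorff_space P -> continuous phi -> closed Q ->
  {within Q, continuous u} -> continuous k ->
  (forall c, Q (phi c) -> k c = u (phi c)) ->
  (forall c c', ~ Q (phi c) -> phi c = phi c' -> k c = k c') ->
  exists w : P -> X,
    [/\ {within Q `|` range phi, continuous w}, forall x, Q x -> w x = u x &
        forall c, w (phi c) = k c].
Proof.
move=> cC hP cphi clQ cu ck ku kk.
pose w x := if pselect (Q x) then u x else
  if pselect (exists c, phi c = x) is left e then k (projT1 (cid e)) else u x.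
have wQ x : Q x -> w x = u x by rewrite /w; case: pselect.
have wphi c : w (phi c) = k c.
  rewrite /w; case: pselect => [Qc|nQ]; first by rewrite ku.
  case: pselect => [e|[]]; last by exists c.
  by case: cid => c' /= e'; apply: kk; rewrite e'.
have clphi A : closed A -> closed (phi @` A).
  move=> clA; apply: compact_closed => //; apply: continuous_compact.
    exact: continuous_subspaceT.
  exact: subclosed_compact clA cC _.
exists w; split => //; apply: withinU_continuous => //.
- exact: (clphi _ closedT).
- by apply: within_eq cu _ => x /wQ.
apply/subspace_continuousP => _ [c _ <-] V.
rewrite -[from_subspace _ _]/w wphi => /nbhs_interior Vk.
rewrite /nbhs /= /within /= near_simpl.
pose A := k @^-1` (~` V^°).
have clA : closed A.
  by move/continuous_closedP : ck; apply; rewrite closedC; exact: open_interior.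
have : nbhs (phi c) (~` (phi @` A)).
  apply: open_nbhs_nbhs; split; first by rewrite openC; exact: clphi.
  move=> [c' nV e]; apply: nV.
  have -> : k c' = k c by rewrite -(wphi c') -(wphi c) e.
  exact: nbhs_singleton.
apply: filterS => x nA [c' _ e].
apply: contrapT => nV; apply: nA; exists c' => //= kV; apply: nV.
by rewrite -e wphi; exact: interior_subset.
Qed.

End relative_continuity.

(** * Continuity into mapping spaces *)

Section mapping_space_continuity.

Lemma chprod_compact (C D : topologicalType) :
  compact [set: C] -> compact [set: D] -> compact [set: (C * D)%type].
Proof. by move=> cC cD; rewrite -setXTT; exact: compact_setX. Qed.

Lemma tube_lemma (C D X : topologicalType) (F : C * D -> X) (U : set X) (c : C) :
  compact [set: D] -> continuous F -> open U -> (forall d, U (F (c, d))) ->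
  \forall c' \near c, forall d, U (F (c', d)).
Proof.
move=> /compact_near_coveringP cD cF oU Uc.
have := cD C (nbhs c) (fun c' d => U (F (c', d))) _.
have H : forall x, [set: D] x ->
    \forall x' \near x & i \near nbhs c, U (F (i, x')).
  move=> d _.
  have [[A B] /= [Ac Bd] AB] := cF (c, d) U (open_nbhs_nbhs (conj oU (Uc d))).
  by exists (B, A) => //= -[d' c'] /= [Bd' Ac']; exact: (AB (c', d')).
by move=> /(_ _ H); apply: filterS => c' h d; exact: (h d Logic.I).
Qed.

(** The subbasic open sets of the mapping space are tested by maps from compact
Hausdorff spaces, so a map into it that is continuous along such maps in both
variables pulls them back to open sets, by the tube lemma. *)
Lemma hom_continuous_test (C : topologicalType) (A X : cgTop) (F : C -> Hom A X) :
  compact [set: C] -> hausdorff_space C ->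
  (forall (D : topologicalType) (s : D -> C) (h : D -> A),
     test_map s -> test_map h -> continuous (fun d => F (s d) (h d))) ->
  continuous F.
Proof.
move=> cC hC FF.
suff: continuous (F : C -> coMap A X).
  by move=> cF; have [] := @test_map_kify (coMap A X) C F (And3 cC hC cF).
apply: co_continuous => _ [C' [h [U [[cC' hC' ch] oU ->]]]].
have cD := chprod_compact cC cC'; have hD := prod_hausdorff hC hC'.
have cG : continuous (fun d : C * C' => F d.1 (h d.2)).
  apply: (FF _ fst (fun d => h d.2)); split => //; first exact: fst_continuous.
  exact: (comp_continuous (@snd_continuous _ _) ch).
rewrite openE => c /= Uc.
by have := @tube_lemma _ _ _ _ U c cC' cG oU Uc.
Qed.

Lemma hom_continuousP (S : topologicalType) (A X : cgTop) (F : S -> Hom A X) :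
  k_space S ->
  (forall (D : topologicalType) (s : D -> S) (h : D -> A),
     test_map s -> test_map h -> continuous (fun d => F (s d) (h d))) ->
  continuous F.
Proof.
move=> kS FF; apply: k_space_continuous => // C t [cC hC ct].
apply: hom_continuous_test => // D s h [cD hD cs] th /=.
by apply: (FF D (t \o s)) => //; split => //; exact: comp_continuous.
Qed.

(** Evaluation is continuous along test maps: the restriction of [h] to a compact
neighbourhood of [c] is again a test map, and it defines a subbasic
neighbourhood of [F c]. *)
Lemma eval_test_continuous (C : topologicalType) (A X : cgTop)
    (F : C -> Hom A X) (h : C -> A) :
  compact [set: C] -> hausdorff_space C ->
  continuous F -> continuous h -> continuous (fun c => F c (h c)).
Proof.
move=> cC hC cF ch c V; rewrite nbhsE => -[U [oU Uc] UV].
have cFc : continuous (fun c' => F c (h c')).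
  by apply: comp_continuous => //; exact: cg_continuous.
have oW : open [set c' | U (F c (h c'))] by move/continuousP : cFc; apply.
have [W Wc WU] := test_map_nbhs cC hC oW Uc.
have tv : test_map (fun x : set_type (closure W) => h (set_val x)).
  split; [|exact: set_type_hausdorff|].
    apply: set_type_compact; apply: (subclosed_compact _ cC) => //.
    exact: closed_closure.
  by apply: comp_continuous ch; exact: set_val_continuous.
pose N : set (coMap A X) := [set f : cgMap A X |
  forall x : set_type (closure W), U (f (h (set_val x)))].
have oN : open N by apply: co_subbase_open; eexists; eexists; exists U; split; [exact: tv| |].
have NF : nbhs (F c : coMap A X) N.
  apply: open_nbhs_nbhs; split => // x; apply: WU; exact: set_valP.
have cF' : continuous (F : C -> coMap A X).
  exact: (comp_continuous cF (@kify_id_continuous _)).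
have FN : nbhs c (F @^-1` N) := cF' c _ NF.
suff : nbhs c ((fun c => F c (h c)) @^-1` V) by [].
apply: filterS2 FN Wc => c' /= Nc' Wc'; apply: UV.
exact: (Nc' (SigSub (mem_set (@subset_closure _ W c' Wc')))).
Qed.

(** A test map into [X_+] is, on the clopen preimage of [X], a test map into
[X], and it is constant on the rest. *)
Lemma plus_test_continuous (P : topologicalType) (Z : topologicalType)
    (D : topologicalType) (h : D -> plus_space P) (F : D -> option P -> Z) (z0 : Z) :
  test_map h -> (forall d, F d None = z0) ->
  (forall (D' : topologicalType) (s : D' -> D) (h' : D' -> P),
     test_map s -> test_map h' -> (forall d, h (s d) = Some (h' d)) ->
     continuous (fun d => F (s d) (Some (h' d)))) ->
  continuous (fun d => F d (h d)).
Proof.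
move=> [cD hD ch] FN FS.
pose O := h @^-1` [set None].
have oO : open O.
  move/continuousP : ch; apply; rewrite /open /= /plus_open.
  rewrite (_ : _ @^-1` _ = set0); first exact: open0.
  by apply/seteqP; split.
have oO' : open (~` O).
  rewrite (_ : ~` O = h @^-1` (~` [set None])) //.
  move/continuousP : ch; apply; rewrite /open /= /plus_open.
  rewrite (_ : _ @^-1` _ = setT); first exact: openT.
  by apply/seteqP; split.
have clO : closed O by rewrite -openC.
have clO' : closed (~` O) by rewrite closedC.
apply: (continuous_glue clO clO').
- apply: (@within_eq _ _ (fun=> z0)).
    by apply: continuous_subspaceT; exact: cst_continuous.
  by move=> d /= ->; rewrite FN.
- pose T := set_type (~` O).
  have ex (d : T) : exists p, h (set_val d) = Some p.
    have := set_valP d; rewrite /O /=.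
    by case: (h _) => [p|] // _; exists p.
  pose h' (d : T) := projT1 (cid (ex d)).
  have hh' d : h (set_val d) = Some (h' d) by rewrite /h'; case: cid.
  have cT : compact [set: T].
    by apply: set_type_compact; exact: subclosed_compact clO' cD _.
  have hT : hausdorff_space T by exact: set_type_hausdorff.
  have ch' : continuous h'.
    apply/continuousP => U oU.
    pose V : set (plus_space P) := Some @` U.
    have oV : open V.
      rewrite /open /= /plus_open (_ : _ @^-1` _ = U) //.
      by apply/seteqP; split => [x [y Uy [<-]]|x Ux] //; exists x.
    rewrite (_ : _ @^-1` _ = set_val @^-1` (h @^-1` V)).
      have /continuousP := @set_val_continuous _ (~` O); apply.
      by move/continuousP : ch; apply.
    apply/seteqP; split => d /=.
      by move=> Ud; exists (h' d).
    by rewrite hh' => -[p Up [<-]].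
  have cF := FS T (@set_val _ _) h'
    (And3 cT hT (@set_val_continuous _ _)) (And3 cT hT ch') hh'.
  rewrite continuous_open_subspace // => d /set_mem nOd.
  have dT : d \in ~` O by exact/mem_set.
  move=> V FV; have := cF (SigSub dT) V.
  have -> : F (set_val (SigSub dT)) (Some (h' (SigSub dT))) = F d (h d).
    by rewrite -hh'.
  move=> /(_ FV); rewrite nbhsE => -[W [[W' oW' WW'] Wd] WV].
  have : nbhs d (W' `&` ~` O).
    apply: open_nbhs_nbhs; split; first exact: openI.
    by split => //; move: Wd; rewrite -WW'.
  apply: filterS => x [W'x nOx]; have xT : x \in ~` O by exact/mem_set.
  have := WV (SigSub xT); rewrite /= -hh'; apply.
  by rewrite -WW'.
- by move=> d; exact: EM.
Qed.

Lemma hom_plus_continuousP (S : topologicalType) (P : chTop) (X : cgTop)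
    (F : S -> Hom (plus P) X) :
  k_space S ->
  (forall (D : topologicalType) (s : D -> S) (h : D -> P),
     test_map s -> test_map h -> continuous (fun d => F (s d) (Some (h d)))) ->
  continuous F.
Proof.
move=> kS FF; apply: hom_continuousP => // D s h [cD hD cs] th.
apply: (@plus_test_continuous P X D h (fun d o => F (s d) o) point) => //.
  by move=> d; rewrite (cg_pointed (F (s d))).
move=> D' s' h' [cD' hD' cs'] th' _; apply: (FF D' (s \o s')) => //.
by split => //; exact: comp_continuous.
Qed.

Definition plus_ext (P : chTop) (X : cgTop) (f : P -> X) : plus P -> X :=
  fun o => if o is Some p then f p else point.

Lemma plus_ext_continuous (P : chTop) (X : cgTop) (f : P -> X) :
  continuous f -> continuous (plus_ext f).
Proof. by move=> /continuousP cf; apply/continuousP => U /cf. Qed.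

Definition plus_cg (P : chTop) (X : cgTop) (f : P -> X) (cf : continuous f) :
  cgMap (plus P) X := CGMap (plus_ext_continuous cf) erefl.

Lemma plus_curry (C P : chTop) (X : cgTop) (f : C -> P -> X) :
  continuous (fun z : C * P => f z.1 z.2) ->
  exists2 F : C -> Hom (plus P) X, continuous F & forall c p, F c (Some p) = f c p.
Proof.
move=> cf.
have cfc c : continuous (f c).
  apply: (@comp_continuous _ _ _ (fun p => (c, p)) _ _ cf).
  by apply: pair_continuous; [exact: cst_continuous|exact: idfun_continuous].
exists (fun c => plus_cg (cfc c)) => //.
apply: hom_plus_continuousP.
  by apply: compact_hausdorff_k_space; [exact: ch_compact|exact: ch_hausdorff].
move=> D s h [_ _ cs] [_ _ ch] /=.
apply: (@comp_continuous _ _ _ (fun d => (s d, h d)) _ _ cf).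
exact: pair_continuous.
Qed.

Lemma plus_uncurry (C P : chTop) (X : cgTop) (F : C -> Hom (plus P) X) :
  continuous F -> continuous (fun z : C * P => F z.1 (Some z.2)).
Proof.
move=> cF; apply: (@eval_test_continuous _ (plus P) X (fun z => F z.1)
  (fun z => Some z.2)).
- exact: prod_compact.
- by apply: prod_hausdorff; exact: ch_hausdorff.
- by apply: comp_continuous cF; exact: fst_continuous.
- exact: (comp_continuous (@snd_continuous _ _) (@Some_continuous _)).
Qed.

End mapping_space_continuity.

(** * Pullbacks, exchange of variables and currying *)

Section pullback.
Context (X Y Z : cgTop) (f : cgMap X Z) (g : cgMap Y Z).

Definition pb_set : set (X * Y)%type := [set z | f z.1 = g z.2].

Definition pb_space : Type := kify (set_type pb_set).
HB.instance Definition _ := Topological.on pb_space.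

Lemma pb_point_subproof : (point : X, point : Y) \in pb_set.
Proof. by apply/mem_set; rewrite /pb_set /= !cg_pointed. Qed.

HB.instance Definition _ := isPointed.Build pb_space (SigSub pb_point_subproof).

Definition pb_fst_fun (z : pb_space) : X := (set_val z).1.
Definition pb_snd_fun (z : pb_space) : Y := (set_val z).2.

Lemma pb_val_continuous : continuous (set_val : pb_space -> (X * Y)%type).
Proof.
exact: (comp_continuous (@kify_id_continuous (set_type pb_set))
          (@set_val_continuous _ pb_set)).
Qed.

Lemma pb_fst_continuous : continuous pb_fst_fun.
Proof. exact: (comp_continuous pb_val_continuous (@fst_continuous _ _)). Qed.

Lemma pb_snd_continuous : continuous pb_snd_fun.
Proof. exact: (comp_continuous pb_val_continuous (@snd_continuous _ _)). Qed.

Lemma pb_k_space : k_space pb_space.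
Proof. exact: kify_k_space. Qed.

Lemma pb_weak_hausdorff : weak_hausdorff pb_space.
Proof.
pose W (b : bool) : topologicalType := if b then X else Y.
pose e (b : bool) : pb_space -> W b :=
  if b return pb_space -> W b then pb_fst_fun else pb_snd_fun.
apply: (@separated_weak_hausdorff _ bool W e); first exact: pb_k_space.
- by case; exact: cg_weak_hausdorff.
- by case; [exact: pb_fst_continuous|exact: pb_snd_continuous].
- move=> z w zw; apply: val_inj.
  rewrite [LHS]surjective_pairing [RHS]surjective_pairing.
  by congr (_, _); [exact: (zw true)|exact: (zw false)].
Qed.

Definition pullback : cgTop := CGTop pb_k_space pb_weak_hausdorff.

Definition pb_fst : cgMap pullback X := @CGMap pullback X pb_fst_fun pb_fst_continuous erefl.
Definition pb_snd : cgMap pullback Y := @CGMap pullback Y pb_snd_fun pb_snd_continuous erefl.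

Lemma pbP (z : pullback) : f (pb_fst z) = g (pb_snd z).
Proof. exact: (set_valP z). Qed.

Lemma pb_eq (z w : pullback) : pb_fst z = pb_fst w -> pb_snd z = pb_snd w -> z = w.
Proof.
move=> e1 e2; apply: val_inj.
by rewrite [LHS]surjective_pairing [RHS]surjective_pairing; congr (_, _).
Qed.

Lemma mem_pb_set (x : X) (y : Y) : f x = g y -> (x, y) \in pb_set.
Proof. by move=> e; exact/mem_set. Qed.

Definition pb_pair (x : X) (y : Y) (e : f x = g y) : pullback :=
  (SigSub (mem_pb_set e) : set_type pb_set).

Lemma pb_continuous (S : topologicalType) (h : S -> pullback) : k_space S ->
  continuous (fun s => pb_fst (h s)) -> continuous (fun s => pb_snd (h s)) ->
  continuous h.
Proof.
move=> kS c1 c2; apply: k_space_continuous => // C t [cC hC ct].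
suff ch : continuous ((fun c => h (t c)) : C -> set_type pb_set).
  by have [] := @test_map_kify (set_type pb_set) C _ (And3 cC hC ch).
apply: continuous_comp_initial.
have -> : set_val \o (fun c => h (t c)) =
    (fun c => (pb_fst (h (t c)), pb_snd (h (t c)))).
  apply/funext => c /=; rewrite /pb_fst_fun /pb_snd_fun.
  by case: (set_val _).
by apply: pair_continuous; [exact: (comp_continuous ct c1)|
  exact: (comp_continuous ct c2)].
Qed.

Section lift.
Context (A : cgTop) (a : cgMap A X) (b : cgMap A Y) (e : forall x, f (a x) = g (b x)).

Lemma pb_lift_continuous : continuous (fun x => pb_pair (e x)).
Proof.
by apply: pb_continuous; [exact: cg_k_space|exact: cg_continuous|exact: cg_continuous].
Qed.

Lemma pb_lift_pointed : pb_pair (e point) = point.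
Proof. by apply: pb_eq; rewrite /= /pb_fst_fun /pb_snd_fun /= cg_pointed. Qed.

Definition pb_lift : cgMap A pullback := CGMap pb_lift_continuous pb_lift_pointed.
End lift.

End pullback.

Section hom_maps.

Lemma hom_eval_continuous (A X : cgTop) (a : A) : continuous (fun h : Hom A X => h a).
Proof.
exact: (@comp_continuous (kify (coMap A X)) (coMap A X) X id (fun h : cgMap A X => h a)
  (@kify_id_continuous _) (@eval_continuous A X a)).
Qed.

Definition hom_eval (A X : cgTop) (a : A) : cgMap (Hom A X) X :=
  @CGMap (Hom A X) X (fun h => h a) (@hom_eval_continuous A X a) erefl.

Lemma hom_pre_continuous (A B X : cgTop) (i : cgMap A B) :
  continuous ((fun h : Hom B X => cg_comp h i) : Hom B X -> Hom A X).
Proof.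
apply: hom_continuousP; first exact: cg_k_space.
move=> D s h [cD hD cs] [_ _ ch] /=.
apply: (@eval_test_continuous D B X s (fun d => i (h d))) => //.
by apply: comp_continuous => //; exact: cg_continuous.
Qed.

Lemma hom_pre_pointed (A B X : cgTop) (i : cgMap A B) :
  cg_comp (point : Hom B X) i = (point : Hom A X).
Proof. exact: cgMap_eq. Qed.

Definition hom_pre (A B X : cgTop) (i : cgMap A B) : cgMap (Hom B X) (Hom A X) :=
  CGMap (@hom_pre_continuous A B X i) (@hom_pre_pointed A B X i).

Section swap.
Context (A B X : cgTop) (F : cgMap A (Hom B X)).

Lemma swap1_continuous (b : B) : continuous (fun a => F a b).
Proof. exact: (comp_continuous (@cg_continuous _ _ F) (@hom_eval_continuous B X b)). Qed.

Lemma swap1_pointed (b : B) : F point b = point.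
Proof. by rewrite cg_pointed. Qed.

Definition swap1 (b : B) : Hom A X := CGMap (@swap1_continuous b) (swap1_pointed b).

Lemma swap_continuous : continuous swap1.
Proof.
apply: hom_continuousP; first exact: cg_k_space.
move=> D s h [cD hD cs] [_ _ ch] /=.
apply: (@eval_test_continuous D B X (fun d => F (h d)) s) => //.
by apply: comp_continuous => //; exact: cg_continuous.
Qed.

Lemma swap_pointed : swap1 point = point.
Proof. by apply: cgMap_eq => a /=; rewrite (cg_pointed (F a)). Qed.

Definition swap : cgMap B (Hom A X) := CGMap swap_continuous swap_pointed.
End swap.

Lemma eval_eval_test_continuous (A B X : cgTop) (D : topologicalType)
    (F : D -> Hom A (Hom B X)) (a : D -> A) (b : D -> B) :
  compact [set: D] -> hausdorff_space D ->
  continuous F -> continuous a -> continuous b ->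
  continuous (fun d => F d (a d) (b d)).
Proof.
move=> cD hD cF ca cb.
apply: (@eval_test_continuous D B X (fun d => F d (a d)) b) => //.
exact: (@eval_test_continuous D A (Hom B X)).
Qed.

Lemma hom_swap_continuous (A B X : cgTop) :
  continuous ((fun F => swap F) : Hom A (Hom B X) -> Hom B (Hom A X)).
Proof.
apply: hom_continuousP; first exact: cg_k_space.
move=> D s b [cD hD cs] [_ _ cb] /=.
apply: hom_continuousP; first exact: compact_hausdorff_k_space.
move=> D' s' a [cD' hD' cs'] [_ _ ca] /=.
apply: (@eval_eval_test_continuous A B X D' (fun d => s (s' d)) a (fun d => b (s' d))) => //.
  exact: comp_continuous.
exact: comp_continuous.
Qed.

Lemma hom_swap_pointed (A B X : cgTop) :
  swap (point : Hom A (Hom B X)) = (point : Hom B (Hom A X)).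
Proof. by apply: cgMap_eq => b; exact: cgMap_eq. Qed.

Definition hom_swap (A B X : cgTop) : cgMap (Hom A (Hom B X)) (Hom B (Hom A X)) :=
  CGMap (@hom_swap_continuous A B X) (@hom_swap_pointed A B X).

Lemma hom_swapK (A B X : cgTop) (F : Hom A (Hom B X)) :
  hom_swap B A X (hom_swap A B X F) = F.
Proof. by apply: cgMap_eq => a; exact: cgMap_eq. Qed.

Lemma hom_swap_natural (A B X Y : cgTop) (f : cgMap X Y) (F : Hom A (Hom B X)) :
  hom_swap A B Y (Hom_map A (Hom_map B f) F) =
  Hom_map B (Hom_map A f) (hom_swap A B X F).
Proof. by apply: cgMap_eq => b; exact: cgMap_eq. Qed.

End hom_maps.

Section smash_curry.
Context (A B X : cgTop).

Lemma kprod_pair_continuous (D : topologicalType) (a : D -> A) (b : D -> B) :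
  test_map a -> test_map b -> continuous ((fun d => (a d, b d)) : D -> kify (A * B)%type).
Proof.
move=> [cD hD ca] [_ _ cb].
have [] // := @test_map_kify (A * B)%type D (fun d => (a d, b d)).
by split => //; exact: pair_continuous.
Qed.

Section curry.
Context (v : cgMap (smash A B) X).

Lemma curry_test_continuous (D : topologicalType) (a : D -> A) (b : D -> B) :
  test_map a -> test_map b -> continuous (fun d => v (smash_pi (a d, b d))).
Proof.
move=> ta tb; apply: (comp_continuous _ (@cg_continuous _ _ v)).
exact: (comp_continuous (kprod_pair_continuous ta tb) (@smash_pi_continuous A B)).
Qed.

Lemma curry1_continuous (a : A) : continuous (fun b => v (smash_pi (a, b))).
Proof.
apply: k_space_continuous; first exact: cg_k_space.
move=> C h th; apply: (@curry_test_continuous C (fun=> a) h) => //.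
by case: th => cC hC _; split => //; exact: cst_continuous.
Qed.

Lemma curry1_pointed (a : A) : v (smash_pi (a, point)) = point.
Proof.
rewrite [smash_pi _](_ : _ = point) ?cg_pointed//.
by apply/smash_point; rewrite /in_wedge eqxx orbT.
Qed.

Definition curry1 (a : A) : Hom B X := CGMap (@curry1_continuous a) (curry1_pointed a).

Lemma curry_continuous : continuous curry1.
Proof.
by apply: hom_continuousP; [exact: cg_k_space|move=> D s h ts th;
  exact: (curry_test_continuous ts th)].
Qed.

Lemma curry_pointed : curry1 point = point.
Proof.
apply: cgMap_eq => b /=; rewrite [smash_pi _](_ : _ = point) ?cg_pointed//.
by apply/smash_point; rewrite /in_wedge eqxx.
Qed.

Definition smash_curry : cgMap A (Hom B X) := CGMap curry_continuous curry_pointed.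
End curry.

Section uncurry.
Context (F : cgMap A (Hom B X)).

Definition uncurry_fun (s : smash A B) : X := F (repr s).1 (repr s).2.

Lemma uncurry_pi (a : A) (b : B) : uncurry_fun (smash_pi (a, b)) = F a b.
Proof.
rewrite /uncurry_fun.
have W (z : kify (A * B)%type) : in_wedge z -> F z.1 z.2 = point.
  case/orP => /eqP ->; last exact: cg_pointed.
  by rewrite cg_pointed.
have : smash_rel (repr (smash_pi (a, b))) (a, b).
  by apply/smash_piP; exact: smash_repr.
case/orP => [/eqP -> //|/andP[/W -> /W /= ->]//].
Qed.

Lemma uncurry_continuous : continuous uncurry_fun.
Proof.
apply/quotient_continuous.
rewrite (_ : _ \o _ = (fun z : kify (A * B)%type => F z.1 z.2)).
  apply: k_space_continuous; first exact: kify_k_space.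
  move=> C h [cC hC ch].
  apply: (@eval_test_continuous C B X (fun c => F (h c).1) (fun c => (h c).2)) => //.
  - apply: (comp_continuous _ (@cg_continuous _ _ F)).
    exact: (comp_continuous ch (@kprod_fst_continuous A B)).
  - exact: (comp_continuous ch (@kprod_snd_continuous A B)).
by apply/funext => -[a b]; exact: uncurry_pi.
Qed.

Lemma uncurry_pointed : uncurry_fun point = point.
Proof. by rewrite [LHS](uncurry_pi point point) !cg_pointed. Qed.

Definition smash_uncurry : cgMap (smash A B) X :=
  CGMap uncurry_continuous uncurry_pointed.
End uncurry.

End smash_curry.

(** * Discs *)

Section real_functions.
Context (R : realType) (T : topologicalType).
Implicit Types f g : T -> R.

Lemma continuous_addr f g : continuous f -> continuous g -> continuous (fun x => f x + g x).
Proof. by move=> cf cg x; apply: cvgD; [exact: cf|exact: cg]. Qed.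

Lemma continuous_oppr f : continuous f -> continuous (fun x => - f x).
Proof. by move=> cf x; apply: cvgN; exact: cf. Qed.

Lemma continuous_mulr f g : continuous f -> continuous g -> continuous (fun x => f x * g x).
Proof. by move=> cf cg x; apply: cvgM; [exact: cf|exact: cg]. Qed.

Lemma continuous_maxr f g :
  continuous f -> continuous g -> continuous (fun x => Num.max (f x) (g x)).
Proof. by move=> cf cg x; apply: continuous_max; [exact: cf|exact: cg]. Qed.

Lemma continuous_minr f g :
  continuous f -> continuous g -> continuous (fun x => Num.min (f x) (g x)).
Proof. by move=> cf cg x; apply: continuous_min; [exact: cf|exact: cg]. Qed.

Lemma continuous_invr f :
  (forall x, f x != 0) -> continuous f -> continuous (fun x => (f x)^-1).
Proof. by move=> f0 cf x; apply: continuousV; [exact: f0|exact: cf]. Qed.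

Lemma continuous_sqrtr f : continuous f -> continuous (fun x => Num.sqrt (f x)).
Proof. by move=> cf; exact: (comp_continuous cf (@sqrt_continuous R)). Qed.

Lemma rV_continuous (n : nat) (f : T -> 'rV[R]_n) :
  (forall i, continuous (fun x => f x ord0 i)) -> continuous f.
Proof.
move=> cf x V [P MP PV].
suff : nbhs x (f @^-1` V) by [].
have H : \forall y \near x, forall i, P ord0 i (f y ord0 i).
  apply: filter_forall => i; exact: (cf i x _ (MP ord0 i)).
apply: filterS H => y H; apply: PV => i j; rewrite (ord1 i); exact: H.
Qed.

Lemma continuous_scale (n : nat) (f : T -> R) (h : T -> 'rV[R]_n) :
  continuous f -> continuous h -> continuous (fun x => f x *: h x).
Proof.
move=> cf ch; apply: rV_continuous => i.
rewrite (_ : (fun _ => _) = fun x => f x * h x ord0 i); last first.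
  by apply/funext => x; rewrite mxE.
by apply: continuous_mulr => //; exact: (comp_continuous ch (@coord_continuous R 1 n ord0 i)).
Qed.

Lemma continuous_addV (n : nat) (f h : T -> 'rV[R]_n) :
  continuous f -> continuous h -> continuous (fun x => f x + h x).
Proof.
move=> cf ch; apply: rV_continuous => i.
rewrite (_ : (fun _ => _) = fun x => f x ord0 i + h x ord0 i); last first.
  by apply/funext => x; rewrite mxE.
apply: continuous_addr.
  exact: (comp_continuous cf (@coord_continuous R 1 n ord0 i)).
exact: (comp_continuous ch (@coord_continuous R 1 n ord0 i)).
Qed.

Lemma continuous_row_mx (l k : nat) (f : T -> 'rV[R]_l) (h : T -> 'rV[R]_k) :
  continuous f -> continuous h -> continuous (fun x => row_mx (f x) (h x)).
Proof.
move=> cf ch; apply: rV_continuous => i.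
case: (split_ordP i) => j ->.
  rewrite (_ : (fun _ => _) = fun x => f x ord0 j); last first.
    by apply/funext => x; rewrite row_mxEl.
  exact: (comp_continuous cf (@coord_continuous R 1 l ord0 j)).
rewrite (_ : (fun _ => _) = fun x => h x ord0 j); last first.
  by apply/funext => x; rewrite row_mxEr.
exact: (comp_continuous ch (@coord_continuous R 1 k ord0 j)).
Qed.

Lemma continuous_lsubmx (l k : nat) (f : T -> 'rV[R]_(l + k)) :
  continuous f -> continuous (fun x => lsubmx (f x)).
Proof.
move=> cf; apply: rV_continuous => i.
rewrite (_ : (fun _ => _) = fun x => f x ord0 (lshift k i)); last first.
  by apply/funext => x; rewrite mxE.
exact: (comp_continuous cf (@coord_continuous R 1 (l + k) ord0 (lshift k i))).
Qed.

Lemma continuous_rsubmx (l k : nat) (f : T -> 'rV[R]_(l + k)) :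
  continuous f -> continuous (fun x => rsubmx (f x)).
Proof.
move=> cf; apply: rV_continuous => i.
rewrite (_ : (fun _ => _) = fun x => f x ord0 (rshift l i)); last first.
  by apply/funext => x; rewrite mxE.
exact: (comp_continuous cf (@coord_continuous R 1 (l + k) ord0 (rshift l i))).
Qed.

Lemma continuous_scalar_mx (f : T -> R) :
  continuous f -> continuous (fun x => (f x)%:M : 'rV[R]_1).
Proof.
move=> cf; apply: rV_continuous => i.
rewrite (_ : (fun _ => _) = f) //.
by apply/funext => x; rewrite mxE (ord1 i) eqxx.
Qed.

End real_functions.

Section euclidean_norm.
Context (R : realType).

Definition nrm (n : nat) (v : 'rV[R]_n) : R := Num.sqrt (\sum_i v ord0 i ^+ 2).

Lemma sqnorm_ge0 (n : nat) (v : 'rV[R]_n) : 0 <= \sum_i v ord0 i ^+ 2.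
Proof. by apply: sumr_ge0 => i _; exact: sqr_ge0. Qed.

Lemma nrm_ge0 (n : nat) (v : 'rV[R]_n) : 0 <= nrm v.
Proof. exact: sqrtr_ge0. Qed.

Lemma sqr_nrm (n : nat) (v : 'rV[R]_n) : nrm v ^+ 2 = \sum_i v ord0 i ^+ 2.
Proof. by rewrite sqr_sqrtr// sqnorm_ge0. Qed.

Lemma continuous_nrm (T : topologicalType) (n : nat) (f : T -> 'rV[R]_n) :
  continuous f -> continuous (fun x => nrm (f x)).
Proof.
move=> cf; apply: continuous_sqrtr.
exact: (comp_continuous cf (@sqnorm_continuous R n)).
Qed.

Lemma nrmZ (n : nat) (c : R) (v : 'rV[R]_n) : nrm (c *: v) = `|c| * nrm v.
Proof.
rewrite /nrm -sqrtr_sqr -sqrtrM ?sqr_ge0// mulr_sumr; congr Num.sqrt.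
by apply: eq_bigr => i _; rewrite mxE exprMn.
Qed.

Lemma nrmZ_ge0 (n : nat) (c : R) (v : 'rV[R]_n) : 0 <= c -> nrm (c *: v) = c * nrm v.
Proof. by move=> c0; rewrite nrmZ ger0_norm. Qed.

Lemma nrm0 (n : nat) : nrm (0 : 'rV[R]_n) = 0.
Proof. by rewrite -(scale0r (0 : 'rV[R]_n)) nrmZ normr0 mul0r. Qed.

Lemma nrm_eq0 (n : nat) (v : 'rV[R]_n) : nrm v = 0 -> v = 0.
Proof.
move=> v0; have : \sum_i v ord0 i ^+ 2 = 0 by rewrite -sqr_nrm v0 expr0n.
move/eqP; rewrite psumr_eq0; last by move=> i _; exact: sqr_ge0.
move=> /allP v2; apply/rowP => i; rewrite mxE; apply/eqP.
by rewrite -sqrf_eq0; have := v2 i; rewrite mem_index_enum => /(_ erefl).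
Qed.

Lemma nrm_le1 (n : nat) (v : 'rV[R]_n) : disc_set v <-> nrm v <= 1.
Proof.
rewrite /disc_set /= -sqr_nrm; split => h.
  by rewrite -(@expr_le1 _ 2) ?nrm_ge0.
by rewrite expr_le1 ?nrm_ge0.
Qed.

Lemma nrm_eq1 (n : nat) (v : 'rV[R]_n) : sphere_set v <-> nrm v = 1.
Proof.
rewrite /sphere_set /= -sqr_nrm; split => [|->]; last by rewrite expr1n.
by move/eqP; rewrite sqrp_eq1 ?nrm_ge0// => /eqP.
Qed.

Lemma sqr_nrm_row_mx (l k : nat) (x : 'rV[R]_l) (y : 'rV[R]_k) :
  nrm (row_mx x y) ^+ 2 = nrm x ^+ 2 + nrm y ^+ 2.
Proof.
rewrite !sqr_nrm big_split_ord /=.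
by congr (_ + _); apply: eq_bigr => i _; rewrite ?row_mxEl ?row_mxEr.
Qed.

Lemma nrm_scalar (c : R) : nrm (c%:M : 'rV[R]_1) = `|c|.
Proof. by rewrite /nrm big_ord1 mxE eqxx mulr1n sqrtr_sqr. Qed.

End euclidean_norm.

Section discs.
Context (R : realType).

Notation D n := (disc R n).
Notation I := (unit_interval R).

Definition bd (n : nat) : set (D n) := [set z | nrm (set_val z) = 1].

Lemma disc_le1 (n : nat) (z : D n) : nrm (set_val z) <= 1.
Proof. by apply/nrm_le1; exact: set_valP. Qed.

Lemma disc_val_inj (n : nat) (z w : D n) : set_val z = set_val w -> z = w.
Proof. exact: val_inj. Qed.

Lemma disc_val_continuous (n : nat) : continuous (set_val : D n -> 'rV[R]_n).
Proof. exact: set_val_continuous. Qed.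

Lemma disc_hausdorff (n : nat) : hausdorff_space (D n).
Proof. exact: ch_hausdorff. Qed.

Lemma itv_val_continuous : continuous (set_val : I -> R).
Proof. exact: set_val_continuous. Qed.

Lemma bd_closed (n : nat) : closed (@bd n).
Proof.
have /continuous_closedP := continuous_nrm (@disc_val_continuous n).
by move=> /(_ _ (@closed_eq R 1)).
Qed.

(** The retraction onto the disc along rays; as it lands in the subtype, every
map into a disc below is written as [clip] of a map into the vector space. *)
Definition clip_fun (n : nat) (v : 'rV[R]_n) : 'rV[R]_n := (Num.max 1 (nrm v))^-1 *: v.

Lemma max1_gt0 (x : R) : 0 < Num.max 1 x.
Proof. by rewrite lt_max ltr01. Qed.

Lemma clip_mem (n : nat) (v : 'rV[R]_n) : clip_fun v \in disc_set (R := R) (n := n).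
Proof.
apply/mem_set/nrm_le1; rewrite /clip_fun nrmZ_ge0 ?invr_ge0 ?(ltW (max1_gt0 _))//.
by rewrite mulrC ler_pdivrMr ?max1_gt0// mul1r le_max lexx orbT.
Qed.

Definition clip (n : nat) (v : 'rV[R]_n) : D n := SigSub (clip_mem v).

Lemma val_clip (n : nat) (v : 'rV[R]_n) : set_val (clip v) = clip_fun v.
Proof. by []. Qed.

Lemma val_clip_id (n : nat) (v : 'rV[R]_n) : nrm v <= 1 -> set_val (clip v) = v.
Proof.
move=> v1; rewrite val_clip /clip_fun (_ : Num.max _ _ = 1) ?invr1 ?scale1r//.
exact/max_idPl.
Qed.

Lemma val_clip_out (n : nat) (v : 'rV[R]_n) :
  1 <= nrm v -> set_val (clip v) = (nrm v)^-1 *: v.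
Proof.
by move=> v1; rewrite val_clip /clip_fun (_ : Num.max _ _ = nrm v)//; exact/max_idPr.
Qed.

Lemma clipK (n : nat) (z : D n) : clip (set_val z) = z.
Proof. by apply: disc_val_inj; rewrite val_clip_id ?disc_le1. Qed.

Lemma bd_clip (n : nat) (v : 'rV[R]_n) : 1 <= nrm v -> bd (clip v).
Proof.
move=> v1; rewrite /bd /= val_clip_out// nrmZ_ge0 ?invr_ge0 ?nrm_ge0//.
by rewrite mulVf// gt_eqF// (lt_le_trans ltr01).
Qed.

Lemma continuous_into_disc (S : topologicalType) (n : nat) (f : S -> D n) :
  continuous (fun x => set_val (f x)) -> continuous f.
Proof. by move=> cf; apply: continuous_comp_initial. Qed.

Lemma clip_continuous (n : nat) : continuous (@clip n).
Proof.
apply: continuous_into_disc; apply: continuous_scale; last exact: idfun_continuous.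
apply: continuous_invr; first by move=> x; rewrite gt_eqF// max1_gt0.
apply: continuous_maxr; first exact: cst_continuous.
by apply: continuous_nrm; exact: idfun_continuous.
Qed.

Lemma continuous_clip (S : topologicalType) (n : nat) (f : S -> 'rV[R]_n) :
  continuous f -> continuous (fun x => clip (f x)).
Proof. by move=> cf; exact: (comp_continuous cf (@clip_continuous n)). Qed.

Lemma clipI_mem (t : R) : Num.max 0 (Num.min 1 t) \in `[(0 : R), 1]%classic.
Proof.
apply/mem_set; rewrite /= in_itv /= le_max lexx /=.
by rewrite ge_max ler01 /= ge_min lexx.
Qed.

Definition clipI (t : R) : I := SigSub (clipI_mem t).

Lemma val_clipI (t : R) : set_val (clipI t) = Num.max 0 (Num.min 1 t).
Proof. by []. Qed.

Lemma val_clipI_id (t : R) : 0 <= t -> t <= 1 -> set_val (clipI t) = t.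
Proof. by move=> t0 t1; rewrite val_clipI (min_idPr t1) (max_idPr t0). Qed.

Lemma itv_ge0 (t : I) : 0 <= set_val t :> R.
Proof. by have := set_valP t; rewrite /= in_itv /= => /andP[]. Qed.

Lemma itv_le1 (t : I) : set_val t <= 1 :> R.
Proof. by have := set_valP t; rewrite /= in_itv /= => /andP[]. Qed.

Lemma itv_val_inj (s t : I) : set_val s = set_val t -> s = t.
Proof. exact: val_inj. Qed.

Lemma val_itv0 : set_val (itv0 R) = 0 :> R.
Proof. by []. Qed.

Lemma val_itv1 : set_val (itv1 R) = 1 :> R.
Proof. by []. Qed.

Lemma clipI0 : clipI 0 = itv0 R.
Proof. by apply: itv_val_inj; rewrite val_clipI_id. Qed.

Lemma clipI1 : clipI 1 = itv1 R.
Proof. by apply: itv_val_inj; rewrite val_clipI_id. Qed.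

Lemma continuous_into_itv (S : topologicalType) (f : S -> I) :
  continuous (fun x => set_val (f x) : R) -> continuous f.
Proof. by move=> cf; apply: continuous_comp_initial. Qed.

Lemma continuous_clipI (S : topologicalType) (f : S -> R) :
  continuous f -> continuous (fun x => clipI (f x)).
Proof.
move=> cf; apply: continuous_into_itv; apply: continuous_maxr.
  exact: cst_continuous.
by apply: continuous_minr => //; exact: cst_continuous.
Qed.

Lemma bd_sphere_incl (n : nat) (v : sphere R n) : bd (sphere_incl v).
Proof. by apply/nrm_eq1; exact: (set_valP v). Qed.

Lemma bd_mem_sphere (n : nat) (z : D n) : bd z -> set_val z \in sphere_set (R := R) (n := n).
Proof. by move=> bz; apply/mem_set/nrm_eq1. Qed.

Definition bd_point (n : nat) (z : D n) (bz : bd z) : sphere R n :=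
  SigSub (bd_mem_sphere bz).

Lemma bd_pointK (n : nat) (z : D n) (bz : bd z) : sphere_incl (bd_point bz) = z.
Proof. exact: disc_val_inj. Qed.

Lemma sphere_incl_inj (n : nat) : injective (@sphere_incl R n).
Proof.
move=> v w /(congr1 (fun z : D n => set_val z)) e; exact: val_inj.
Qed.

Lemma continuous_into_sphere (S : topologicalType) (n : nat) (f : S -> sphere R n) :
  continuous (fun x => set_val (f x)) -> continuous f.
Proof. by move=> cf; apply: continuous_comp_initial. Qed.

(** The sphere is empty in dimension 0, so that a total map from the disc to it
has to take its values in the sphere with a point added. *)
Definition to_sphere (n : nat) (z : D n) : plus (sphere R n) :=
  if pselect (bd z) is left bz then Some (bd_point bz) else None.

Lemma to_sphereE (n : nat) (z : D n) (bz : bd z) : to_sphere z = Some (bd_point bz).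
Proof.
rewrite /to_sphere; case: pselect => // bz'.
by congr Some; apply: sphere_incl_inj; rewrite !bd_pointK.
Qed.

Lemma to_sphere_incl (n : nat) (v : sphere R n) : to_sphere (sphere_incl v) = Some v.
Proof.
by rewrite (to_sphereE (bd_sphere_incl v)); congr Some; apply: sphere_incl_inj; rewrite bd_pointK.
Qed.

Lemma to_sphere_within (n : nat) : {within @bd n, continuous (@to_sphere n)}.
Proof.
apply/subspace_continuousP => z bz V.
rewrite -[from_subspace _ _]/(@to_sphere n) (to_sphereE bz).
rewrite nbhsE => -[U [oU Uz] UV].
have : open (Some @^-1` U : set (sphere R n)) by [].
move=> [W oW WU].
suff : \forall y \near z, bd y -> V (to_sphere y) by [].
have : nbhs z (set_val @^-1` W).
  apply: open_nbhs_nbhs; split; first by move/continuousP : (@disc_val_continuous n); apply.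
  by have : (Some @^-1` U) (bd_point bz) by []; rewrite -WU.
apply: filterS => y Wy by_; apply: UV; rewrite (to_sphereE by_).
by suff : (Some @^-1` U) (bd_point by_) by []; rewrite -WU.
Qed.

End discs.

(** * Cells: products of discs, cylinders, spheres *)

Section cells.
Context (R : realType).

Notation D n := (disc R n).
Notation I := (unit_interval R).

Definition disc_pair (n : nat) (P : topologicalType) (Q : set P) : Prop :=
  exists (f : D n -> P) (g : P -> D n),
    [/\ continuous f, continuous g, cancel f g, cancel g f &
        forall z, bd z <-> Q (f z)].

Section product_of_discs.
Context (l k : nat).
Implicit Types v w : 'rV[R]_(l + k).

Definition mnrm v : R := Num.max (nrm (lsubmx v)) (nrm (rsubmx v)).

Lemma mnrm_ge0 v : 0 <= mnrm v.
Proof. by rewrite le_max nrm_ge0. Qed.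

Lemma nrm_split v : nrm v ^+ 2 = nrm (lsubmx v) ^+ 2 + nrm (rsubmx v) ^+ 2.
Proof. by rewrite -sqr_nrm_row_mx hsubmxK. Qed.

Lemma mnrm_le v : mnrm v <= nrm v.
Proof.
by rewrite ge_max; apply/andP; split;
  rewrite -(@ler_pXn2r _ 2) ?nnegrE ?nrm_ge0// nrm_split ?lerDl ?lerDr sqr_ge0.
Qed.

Lemma mnrmZ (c : R) v : 0 <= c -> mnrm (c *: v) = c * mnrm v.
Proof.
move=> c0; rewrite /mnrm (_ : lsubmx _ = c *: lsubmx v); last first.
  by apply/rowP => i; rewrite !mxE.
rewrite (_ : rsubmx _ = c *: rsubmx v); last by apply/rowP => i; rewrite !mxE.
by rewrite !nrmZ_ge0// maxr_pMr.
Qed.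

Lemma mnrm_eq0 v : mnrm v = 0 -> nrm v = 0.
Proof.
move=> v0; have [l0 r0] : nrm (lsubmx v) = 0 /\ nrm (rsubmx v) = 0.
  split; apply/le_anti; rewrite nrm_ge0 andbT -v0 /mnrm le_max lexx ?orbT//.
by apply/eqP; rewrite -sqrf_eq0 nrm_split l0 r0 expr0n addr0.
Qed.

(** The ball of the norm [N] is mapped onto the ball of the smaller norm [m] by
rescaling each ray. The factor [1 / (1 - N + m)] is [1 / m] on the unit sphere
of [N] and, unlike the quotient [N / m], has no singularity at the origin. *)
Definition stretch v := (1 - nrm v + mnrm v)^-1 *: v.
Definition shrink w := (1 + nrm w - mnrm w)^-1 *: w.

Lemma stretch_gt0 v : nrm v <= 1 -> 0 < 1 - nrm v + mnrm v.
Proof.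
rewrite le_eqVlt => /orP[/eqP v1|v1].
  rewrite v1 subrr add0r lt_neqAle mnrm_ge0 andbT; apply/eqP => /esym /mnrm_eq0.
  by rewrite v1 => /eqP; rewrite oner_eq0.
by rewrite ltr_wpDr ?mnrm_ge0// subr_gt0.
Qed.

Lemma shrink_gt0 w : 0 < 1 + nrm w - mnrm w.
Proof. by have := mnrm_le w; lra. Qed.

Lemma mnrm_stretch v : nrm v <= 1 ->
  mnrm (stretch v) <= 1 /\ (mnrm (stretch v) = 1 <-> nrm v = 1).
Proof.
move=> v1; have d0 := stretch_gt0 v1; have dn : 1 - nrm v + mnrm v != 0 by rewrite gt_eqF.
rewrite mnrmZ ?invr_ge0 ?(ltW d0)//; split.
  by rewrite mulrC ler_pdivrMr//; lra.
split=> [/(congr1 (fun x => x * (1 - nrm v + mnrm v)))|e].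
  by rewrite mulrAC mulVf// !mul1r; lra.
by rewrite e subrr add0r mulVf//; move: dn; rewrite e subrr add0r.
Qed.

Lemma nrm_shrink w : mnrm w <= 1 -> nrm (shrink w) <= 1.
Proof.
move=> w1; have e0 := shrink_gt0 w.
by rewrite nrmZ_ge0 ?invr_ge0 ?(ltW e0)// mulrC ler_pdivrMr//; lra.
Qed.

Lemma stretchK v : nrm v <= 1 -> shrink (stretch v) = v.
Proof.
move=> v1; have d0 := stretch_gt0 v1; have dn : 1 - nrm v + mnrm v != 0 by rewrite gt_eqF.
rewrite /shrink {3}/stretch scalerA.
rewrite nrmZ_ge0 ?mnrmZ ?invr_ge0 ?(ltW d0)//.
set d := 1 - nrm v + mnrm v in d0 dn *.
rewrite (_ : 1 + d^-1 * nrm v - d^-1 * mnrm v = d^-1); last first.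
  by rewrite /d; field.
by rewrite invrK mulfV// scale1r.
Qed.

Lemma shrinkK w : stretch (shrink w) = w.
Proof.
have e0 := shrink_gt0 w; have en : 1 + nrm w - mnrm w != 0 by rewrite gt_eqF.
rewrite /stretch {3}/shrink scalerA.
rewrite nrmZ_ge0 ?mnrmZ ?invr_ge0 ?(ltW e0)//.
set e := 1 + nrm w - mnrm w in e0 en *.
rewrite (_ : 1 - e^-1 * nrm w + e^-1 * mnrm w = e^-1); last by rewrite /e; field.
by rewrite invrK mulfV// scale1r.
Qed.

Lemma continuous_mnrm (S : topologicalType) (f : S -> 'rV[R]_(l + k)) :
  continuous f -> continuous (fun x => mnrm (f x)).
Proof.
move=> cf; apply: continuous_maxr; apply: continuous_nrm.
  exact: continuous_lsubmx.
exact: continuous_rsubmx.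
Qed.

Definition prod_bd : set (D l * D k)%type := [set p | bd p.1 \/ bd p.2].

Lemma max_eq1 (a b : R) : a <= 1 -> b <= 1 -> Num.max a b = 1 <-> a = 1 \/ b = 1.
Proof.
move=> a1 b1; split => [|[->|->]]; last 2 first.
- exact/max_idPl.
- exact/max_idPr.
by case: (leP a b) => _ ->; [right|left].
Qed.

Lemma prod_disc_pair : disc_pair (l + k) prod_bd.
Proof.
pose f (z : D (l + k)) : D l * D k :=
  (clip (lsubmx (stretch (set_val z))), clip (rsubmx (stretch (set_val z)))).
pose g (p : D l * D k) : D (l + k) := clip (shrink (row_mx (set_val p.1) (set_val p.2))).
have sz (z : D (l + k)) : nrm (lsubmx (stretch (set_val z))) <= 1 /\
            nrm (rsubmx (stretch (set_val z))) <= 1.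
  have [] := mnrm_stretch (disc_le1 z).
  by rewrite /mnrm ge_max => /andP[].
have sp (p : D l * D k) : mnrm (row_mx (set_val p.1) (set_val p.2)) <= 1.
  by rewrite /mnrm row_mxKl row_mxKr ge_max !disc_le1.
have cs : continuous (fun z : D (l + k) => stretch (set_val z)).
  apply: continuous_scale; last exact: disc_val_continuous.
  apply: continuous_invr.
    by move=> z; rewrite gt_eqF// stretch_gt0// disc_le1.
  apply: continuous_addr.
    apply: continuous_addr; first exact: cst_continuous.
    by apply: continuous_oppr; apply: continuous_nrm; exact: disc_val_continuous.
  by apply: continuous_mnrm; exact: disc_val_continuous.
have cr : continuous (fun p : D l * D k => row_mx (set_val p.1) (set_val p.2)).
  apply: continuous_row_mx.
    exact: (comp_continuous (@fst_continuous _ _) (@disc_val_continuous R l)).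
  exact: (comp_continuous (@snd_continuous _ _) (@disc_val_continuous R k)).
exists f, g; split.
- by apply: pair_continuous; apply: continuous_clip;
    [exact: continuous_lsubmx|exact: continuous_rsubmx].
- apply: continuous_clip; apply: continuous_scale => //.
  apply: continuous_invr; first by move=> p; rewrite gt_eqF// shrink_gt0.
  apply: continuous_addr; last by apply: continuous_oppr; exact: continuous_mnrm.
  by apply: continuous_addr; [exact: cst_continuous|exact: continuous_nrm].
- move=> z; apply: disc_val_inj; rewrite /g /f /=.
  have [s1 s2] := sz z.
  by rewrite (val_clip_id s1) (val_clip_id s2) hsubmxK stretchK ?disc_le1// val_clip_id ?disc_le1.
- move=> [x y]; rewrite /f /g /=.
  rewrite val_clip_id ?nrm_shrink ?(sp (x, y))// shrinkK row_mxKl row_mxKr.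
  by rewrite !clipK.
- move=> z; have [s1 s2] := sz z.
  have [_ e] := mnrm_stretch (disc_le1 z).
  rewrite /prod_bd /f /bd /= (val_clip_id s1) (val_clip_id s2).
  by rewrite -(max_eq1 s1 s2); apply: iff_sym.
Qed.

End product_of_discs.

Section cylinders.
Context (k : nat).

Definition cyl_bd : set (cylinder R k) :=
  [set p | [\/ bd p.1, p.2 = itv0 R | p.2 = itv1 R]].

Lemma cyl_disc_pair : disc_pair (k + 1) cyl_bd.
Proof.
have [f [g [cf cg fK gK fbd]]] := prod_disc_pair k 1.
pose f1 (s : D 1) : I := clipI ((1 + set_val s ord0 ord0) / 2).
pose g1 (t : I) : D 1 := clip ((2 * set_val t - 1)%:M).
have s1 (s : D 1) : - 1 <= set_val s ord0 ord0 <= 1.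
  by have := disc_le1 s; rewrite [set_val s]mx11_scalar nrm_scalar ler_norml mxE eqxx mulr1n.
have vf1 (s : D 1) : set_val (f1 s) = (1 + set_val s ord0 ord0) / 2.
  by rewrite val_clipI_id//; have := s1 s; lra.
have vg1 (t : I) : set_val (g1 t) = (2 * set_val t - 1)%:M.
  rewrite val_clip_id// nrm_scalar ler_norml.
  by have := itv_ge0 t; have := itv_le1 t; lra.
have f1K : cancel f1 g1.
  move=> s; apply: disc_val_inj; rewrite vg1 vf1 [RHS]mx11_scalar; congr (_%:M).
  by lra.
have g1K : cancel g1 f1.
  move=> t; apply: itv_val_inj; rewrite vf1 vg1 mxE eqxx mulr1n; lra.
have cf1 : continuous f1.
  apply: continuous_clipI; apply: continuous_mulr; last exact: cst_continuous.
  apply: continuous_addr; first exact: cst_continuous.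
  exact: (comp_continuous (@disc_val_continuous R 1) (@coord_continuous R 1 1 ord0 ord0)).
have cg1 : continuous g1.
  apply: continuous_clip; apply: continuous_scalar_mx.
  apply: continuous_addr; last exact: cst_continuous.
  apply: continuous_mulr; first exact: cst_continuous.
  exact: itv_val_continuous.
have bd1 (s : D 1) : bd s <-> f1 s = itv0 R \/ f1 s = itv1 R.
  have e : nrm (set_val s) = `|set_val s ord0 ord0|.
    by rewrite [in LHS](mx11_scalar (set_val s)) nrm_scalar.
  rewrite /bd /= e; split => [h|[]/(congr1 (fun t : I => set_val t))].
  - have : set_val s ord0 ord0 = 1 \/ set_val s ord0 ord0 = -1.
      by move/eqP : h; rewrite eqr_norml => /andP[/orP[] /eqP -> _]; [left|right].
    by case=> {}e; [right|left]; apply: itv_val_inj; rewrite vf1 e ?val_itv0 ?val_itv1; lra.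
  - rewrite vf1 ?val_itv0 ?val_itv1 => h; have -> : set_val s ord0 ord0 = -1 by lra.
    by rewrite normrN1.
  - rewrite vf1 ?val_itv0 ?val_itv1 => h; have -> : set_val s ord0 ord0 = 1 by lra.
    by rewrite normr1.
exists (fun z => ((f z).1, f1 (f z).2)), (fun p => g (p.1, g1 p.2)); split.
- apply: pair_continuous; first exact: (comp_continuous cf (@fst_continuous _ _)).
  by apply: comp_continuous cf1; exact: (comp_continuous cf (@snd_continuous _ _)).
- apply: comp_continuous cg; apply: pair_continuous; first exact: fst_continuous.
  exact: (comp_continuous (@snd_continuous _ _) cg1).
- by move=> z /=; rewrite f1K -surjective_pairing fK.
- by move=> [z t]; rewrite gK /= g1K.
- move=> z; rewrite fbd /prod_bd /cyl_bd /= bd1; split.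
    by case=> [|[]]; [constructor 1|constructor 2|constructor 3].
  by case; [left|right; left|right; right].
Qed.

(** The lid and the side of the cylinder form one cell, attached to the bottom
along its boundary. *)
Definition lid (z : D k) : cylinder R k :=
  (clip (2 *: set_val z), clipI (2 - 2 * nrm (set_val z))).

Lemma lid_continuous : continuous lid.
Proof.
apply: pair_continuous.
  apply: continuous_clip; apply: continuous_scale; first exact: cst_continuous.
  exact: disc_val_continuous.
apply: continuous_clipI; apply: continuous_addr; first exact: cst_continuous.
apply: continuous_oppr; apply: continuous_mulr; first exact: cst_continuous.
by apply: continuous_nrm; exact: disc_val_continuous.
Qed.

Lemma lid_bottom (z : D k) : (lid z).2 = itv0 R <-> bd z.
Proof.
rewrite /lid /bd /=; split => [/(congr1 (fun t : I => set_val t))|->].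
  rewrite val_clipI val_itv0 /= => e.
  have := disc_le1 z; have := nrm_ge0 (set_val z).
  move: (nrm (set_val z)) e => r e r0 r1.
  have h : Num.min 1 (2 - 2 * r) <= 0 by rewrite -e le_max lexx orbT.
  by move: h; rewrite ge_min; lra.
by rewrite mulr1 subrr clipI0.
Qed.

Lemma lid_inj : injective lid.
Proof.
move=> z w e.
have e1 : set_val (clip (2 *: set_val z)) = set_val (clip (2 *: set_val w)).
  exact: (congr1 (fun p : cylinder R k => set_val p.1) e).
have e2 : set_val (clipI (2 - 2 * nrm (set_val z))) =
          set_val (clipI (2 - 2 * nrm (set_val w))).
  exact: (congr1 (fun p : cylinder R k => set_val p.2) e).
have n2 (x : D k) : nrm (2 *: set_val x) = 2 * nrm (set_val x).
  by rewrite nrmZ_ge0.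
have in2 (x : D k) : nrm (set_val x) <= 2^-1 ->
    set_val (clip (2 *: set_val x)) = 2 *: set_val x.
  by move=> h; rewrite val_clip_id// n2; lra.
have out2 (x : D k) : 2^-1 <= nrm (set_val x) ->
    set_val (clip (2 *: set_val x)) = (nrm (set_val x))^-1 *: set_val x.
  move=> h; rewrite val_clip_out ?n2; last lra.
  by rewrite scalerA; congr (_ *: _); field; rewrite gt_eqF//; lra.
have lv (x : D k) : nrm (set_val x) <= 2^-1 -> set_val (clipI (2 - 2 * nrm (set_val x))) = 1.
  by move=> h; rewrite val_clipI; rewrite (min_idPl _) ?(max_idPr _)//; lra.
have sv (x : D k) : 2^-1 <= nrm (set_val x) ->
    set_val (clipI (2 - 2 * nrm (set_val x))) = 2 - 2 * nrm (set_val x).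
  by move=> h; rewrite val_clipI_id//; have := disc_le1 x; lra.
apply: disc_val_inj; case: (leP (nrm (set_val z)) 2^-1) => hz.
- have hw : nrm (set_val w) <= 2^-1.
    case: (leP (nrm (set_val w)) 2^-1) => // hw.
    by move: e2; rewrite lv// sv ?ltW//; lra.
  by move: e1; rewrite !in2//; apply: scalerI; rewrite pnatr_eq0.
- have hw : 2^-1 < nrm (set_val w).
    case: (leP (nrm (set_val w)) 2^-1) => // hw.
    by move: e2; rewrite (lv w)// sv ?ltW//; lra.
  have nzw : nrm (set_val z) = nrm (set_val w).
    by move: e2; rewrite !sv ?ltW//; lra.
  move: e1; rewrite !out2 ?ltW// nzw; apply: scalerI.
  by rewrite invr_eq0 gt_eqF//; lra.
Qed.

Lemma lid_cover (p : cylinder R k) : cyl_bd p -> p.2 = itv0 R \/ exists z, lid z = p.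
Proof.
case: p => z t [bz|e|e]; [right|by left|right].
- pose w := (1 - set_val t / 2) *: set_val z.
  have nw : nrm w = 1 - set_val t / 2.
    by rewrite nrmZ_ge0 ?[nrm _]bz ?mulr1//; have := itv_le1 t; lra.
  have vw : set_val (clip w) = w.
    by rewrite val_clip_id// nw; have := itv_ge0 t; lra.
  have {}bz : nrm (set_val z) = 1 := bz.
  exists (clip w); rewrite /lid vw nw; congr (_, _).
    apply: disc_val_inj; have n2 : nrm (2 *: w) = 2 - set_val t.
      by rewrite nrmZ_ge0// nw; lra.
    have t1 := itv_le1 t.
    rewrite val_clip_out n2; last lra.
    rewrite /w !scalerA (_ : _ * _ = 1) ?scale1r//.
    by field; rewrite gt_eqF//; lra.
  by apply: itv_val_inj; rewrite val_clipI_id; have := itv_ge0 t; have := itv_le1 t; lra.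
- pose w := 2^-1 *: set_val z.
  have z1 := disc_le1 z.
  have nw : nrm w = nrm (set_val z) / 2 by rewrite nrmZ_ge0 1?mulrC// invr_ge0.
  have vw : set_val (clip w) = w by rewrite val_clip_id// nw; lra.
  exists (clip w); rewrite /lid vw nw; congr (_, _).
    by rewrite /w scalerA mulfV ?scale1r ?clipK// pnatr_eq0.
  move: e => /= ->; apply: itv_val_inj; rewrite val_clipI (min_idPl _) ?(max_idPr _)//.
  by lra.
Qed.

End cylinders.

Section spheres.
Context (m : nat).

Definition pole_val : 'rV[R]_(1 + m) := row_mx 1%:M 0.

Definition collapse_val (v : 'rV[R]_m) : 'rV[R]_(1 + m) :=
  row_mx (2 * nrm v ^+ 2 - 1)%:M ((2 * Num.sqrt (1 - nrm v ^+ 2)) *: v).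

Lemma pole_mem : (pole_val : 'rV[R]_m.+1) \in sphere_set (R := R) (n := m.+1).
Proof.
apply/mem_set/nrm_eq1; apply/eqP; rewrite -(@eqrXn2 _ 2) ?nrm_ge0//.
by rewrite [X in X == _](@sqr_nrm_row_mx R 1 m) nrm_scalar nrm0 normr1 expr0n addr0.
Qed.

Definition pole : sphere R m.+1 := SigSub pole_mem.

Lemma sqr_sub_ge0 (v : 'rV[R]_m) : nrm v <= 1 -> 0 <= 1 - nrm v ^+ 2.
Proof. by move=> v1; rewrite subr_ge0 expr_le1// nrm_ge0. Qed.

Lemma collapse_mem (z : D m) :
  (collapse_val (set_val z) : 'rV[R]_m.+1) \in sphere_set (R := R) (n := m.+1).
Proof.
apply/mem_set/nrm_eq1; apply/eqP; rewrite -(@eqrXn2 _ 2) ?nrm_ge0//.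
rewrite [X in X == _](@sqr_nrm_row_mx R 1 m) nrm_scalar real_normK ?num_real//.
rewrite nrmZ_ge0 ?mulr_ge0 ?sqrtr_ge0// !exprMn (sqr_sqrtr (sqr_sub_ge0 (disc_le1 z))).
by apply/eqP; ring.
Qed.

(** [D^m / S^(m-1) = S^m]: the boundary of the disc is collapsed to the pole. *)
Definition collapse (z : D m) : sphere R m.+1 := SigSub (collapse_mem z).

Lemma collapse_continuous : continuous collapse.
Proof.
apply: continuous_into_sphere; apply: (@continuous_row_mx R _ 1 m).
- apply: continuous_scalar_mx; apply: continuous_addr; last exact: cst_continuous.
  apply: continuous_mulr; first exact: cst_continuous.
  under eq_fun do rewrite expr2.
  by apply: continuous_mulr; apply: continuous_nrm; exact: disc_val_continuous.
- apply: continuous_scale; last exact: disc_val_continuous.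
  apply: continuous_mulr; first exact: cst_continuous.
  apply: continuous_sqrtr; apply: continuous_addr; first exact: cst_continuous.
  apply: continuous_oppr; under eq_fun do rewrite expr2.
  by apply: continuous_mulr; apply: continuous_nrm; exact: disc_val_continuous.
Qed.

Lemma collapse_eq (z w : D m) : collapse z = collapse w ->
  nrm (set_val z) = nrm (set_val w) /\
  (2 * Num.sqrt (1 - nrm (set_val z) ^+ 2)) *: set_val z =
  (2 * Num.sqrt (1 - nrm (set_val w) ^+ 2)) *: set_val w.
Proof.
move=> /(congr1 (fun y : sphere R m.+1 => (set_val y : 'rV[R]_(1 + m)))) /=.
move=> /(@eq_row_mx _ 1 1 m) [/matrixP /(_ ord0 ord0)]; rewrite !mxE eqxx !mulr1n => e1 e2.
split => //; apply/eqP; rewrite -(@eqrXn2 _ 2) ?nrm_ge0//; apply/eqP.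
by lra.
Qed.

Lemma collapse_pole (z : D m) : collapse z = pole <-> bd z.
Proof.
split => [|bz].
  move=> /(congr1 (fun y : sphere R m.+1 => (set_val y : 'rV[R]_(1 + m)))) /=.
  move=> /(@eq_row_mx _ 1 1 m) [/matrixP /(_ ord0 ord0)]; rewrite !mxE eqxx !mulr1n => e1 _.
  by apply/eqP; rewrite -(@eqrXn2 _ 2) ?nrm_ge0// expr1n; apply/eqP; lra.
apply: val_inj => /=; rewrite /collapse_val bz expr1n subrr sqrtr0 mulr0 scale0r.
by congr (row_mx _%:M _); lra.
Qed.

Lemma collapse_inj (z w : D m) : collapse z = collapse w -> z = w \/ bd z /\ bd w.
Proof.
move=> /[dup] e /collapse_eq [e1 e2].
have [bw|bw] := pselect (bd w); first by right; rewrite /bd /= e1.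
left; apply: disc_val_inj; move: e2; rewrite e1; apply: scalerI.
rewrite mulf_neq0 ?pnatr_eq0// gt_eqF// sqrtr_gt0 subr_gt0 expr_lt1 ?nrm_ge0//.
by rewrite lt_neqAle disc_le1 andbT; apply/eqP.
Qed.

Lemma collapse_surj (y : sphere R m.+1) : y <> pole -> exists z, collapse z = y.
Proof.
move=> yp; pose v : 'rV[R]_(1 + m) := set_val y.
pose a := v ord0 (lshift m ord0); pose b := rsubmx v.
have va : lsubmx v = a%:M by rewrite [LHS]mx11_scalar mxE.
have vE : v = row_mx a%:M b by rewrite -va hsubmxK.
have n1 : nrm v = 1 by apply/nrm_eq1; exact: (set_valP y).
have ab : a ^+ 2 + nrm b ^+ 2 = 1.
  by rewrite -(expr1n _ 2) -n1 [in RHS]vE sqr_nrm_row_mx nrm_scalar real_normK ?num_real.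
have a1 : a < 1.
  rewrite lt_neqAle; apply/andP; split; last first.
    by have := sqr_ge0 (nrm b); nra.
  apply/eqP => e; apply: yp; apply: val_inj.
  suff : v = pole_val by [].
  rewrite vE e; congr (row_mx _ _); apply: nrm_eq0; apply/eqP; rewrite -sqrf_eq0.
  by apply/eqP; rewrite e in ab; lra.
pose s := Num.sqrt ((1 - a) / 2).
have s0 : 0 < s by rewrite sqrtr_gt0; lra.
have s2 : s ^+ 2 = (1 - a) / 2 by rewrite sqr_sqrtr//; lra.
pose w := (2 * s)^-1 *: b.
have w2 : nrm w ^+ 2 = (1 + a) / 2.
  rewrite nrmZ_ge0 ?invr_ge0 ?mulr_ge0 ?(ltW s0)// exprMn exprVn exprMn s2.
  rewrite (_ : nrm b ^+ 2 = (1 - a) * (1 + a)); last by lra.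
  by field; rewrite gt_eqF//; lra.
have w1 : nrm w <= 1.
  by rewrite -(@expr_le1 _ 2) ?nrm_ge0// w2; lra.
exists (clip w); apply: val_inj.
suff : collapse_val (set_val (clip w)) = v by [].
rewrite vE /collapse_val (val_clip_id w1) w2 (_ : 1 - (1 + a) / 2 = (1 - a) / 2); last by lra.
rewrite -/s /w scalerA mulfV ?scale1r; last by rewrite mulf_neq0 ?pnatr_eq0// gt_eqF.
by congr (row_mx _%:M _); lra.
Qed.

End spheres.

End cells.

(** * Acyclic maps *)

Section acyclic_maps.
Context (R : realType).

Notation D n := (disc R n).
Notation I := (unit_interval R).

(** The right lifting property against the inclusions of spheres into discs. The
map [u] is defined on the whole disc, but only its restriction to the bounding
sphere has to be continuous: thus lifting data can be glued from maps on closed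
pieces, and the empty sphere needs no separate treatment. *)
Definition acyclic (E B : topologicalType) (p : E -> B) : Prop :=
  forall (n : nat) (u : D n -> E) (v : D n -> B),
    {within @bd R n, continuous u} -> continuous v ->
    (forall z, bd z -> p (u z) = v z) ->
    exists w : D n -> E,
      [/\ continuous w, forall z, bd z -> w z = u z & forall z, p (w z) = v z].

Lemma acyclic_attach (E B P : topologicalType) (p : E -> B) (n : nat)
    (phi : D n -> P) (Q : set P) (u : P -> E) (v : P -> B) :
  acyclic p -> hausdorff_space P -> continuous phi -> closed Q ->
  (forall z, bd z <-> Q (phi z)) ->
  (forall z z', ~ bd z -> phi z = phi z' -> z = z') ->
  {within Q, continuous u} -> continuous v -> (forall x, Q x -> p (u x) = v x) ->
  exists w : P -> E,
    [/\ {within Q `|` range phi, continuous w}, forall x, Q x -> w x = u x &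
        forall x, (Q `|` range phi) x -> p (w x) = v x].
Proof.
move=> ap hP cphi clQ bdQ inj cu cv pu.
have [k [ck ku pk]] : exists k : D n -> E, [/\ continuous k,
    forall z, bd z -> k z = u (phi z) & forall z, p (k z) = v (phi z)].
  apply: ap.
  - apply: (within_comp (A := Q)) => //; first exact: continuous_subspaceT.
    by move=> z /bdQ.
  - exact: comp_continuous.
  - by move=> z /bdQ; exact: pu.
have [w [cw wQ wphi]] : exists w : P -> E,
    [/\ {within Q `|` range phi, continuous w}, forall x, Q x -> w x = u x &
        forall c, w (phi c) = k c].
  apply: compact_glue => //; first exact: ch_compact.
  - by move=> z /bdQ; exact: ku.
  - move=> z z' nQ e; congr k; apply: inj => // bz; apply: nQ; exact/bdQ.
exists w; split => // x [Qx|[z _ <-]]; first by rewrite wQ// pu.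
by rewrite wphi pk.
Qed.

Lemma acyclic_pair (E B P : topologicalType) (p : E -> B) (n : nat) (Q : set P)
    (u : P -> E) (v : P -> B) :
  acyclic p -> disc_pair R n Q ->
  {within Q, continuous u} -> continuous v -> (forall x, Q x -> p (u x) = v x) ->
  exists w : P -> E,
    [/\ continuous w, forall x, Q x -> w x = u x & forall x, p (w x) = v x].
Proof.
move=> ap [f [g [cf cg fK gK fbd]]] cu cv pu.
have [k [ck ku pk]] : exists k : D n -> E, [/\ continuous k,
    forall z, bd z -> k z = u (f z) & forall z, p (k z) = v (f z)].
  apply: ap.
  - apply: (within_comp (A := Q)) => //; first exact: continuous_subspaceT.
    by move=> z /fbd.
  - exact: comp_continuous.
  - by move=> z /fbd; exact: pu.
exists (fun x => k (g x)); split.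
- exact: comp_continuous.
- by move=> x Qx; rewrite ku ?gK//; apply/fbd; rewrite gK.
- by move=> x; rewrite pk gK.
Qed.

Lemma bottom_closed (n : nat) : closed [set x : cylinder R n | x.2 = itv0 R].
Proof.
have /continuous_closedP := @snd_continuous (D n) I.
move=> /(_ [set itv0 R]); apply.
by apply: compact_closed; [exact: ch_hausdorff|exact: compact_set1].
Qed.

(** Extend the lift first over the lid, then over the whole cylinder relative to
its boundary. *)
Lemma acyclic_cylinder (E B : topologicalType) (p : E -> B) (n : nat)
    (u : D n -> E) (v : cylinder R n -> B) :
  acyclic p -> continuous u -> continuous v -> (forall z, p (u z) = v (z, itv0 R)) ->
  exists w : cylinder R n -> E,
    [/\ continuous w, forall z, w (z, itv0 R) = u z & forall x, p (w x) = v x].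
Proof.
move=> ap cu cv pu.
have puv x : x.2 = itv0 R -> p (u x.1) = v x.
  by move=> e; rewrite pu -e -surjective_pairing.
have cu1 : {within [set x : cylinder R n | x.2 = itv0 R], continuous (fun x => u x.1)}.
  by apply: continuous_subspaceT; exact: (comp_continuous (@fst_continuous _ _) cu).
have [w [cw wQ pw]] := acyclic_attach ap (@ch_hausdorff (cylinder R n))
  (@lid_continuous R n) (@bottom_closed n) (fun z => iff_sym (lid_bottom z))
  (fun z z' _ => @lid_inj R n z z') cu1 cv puv.
have bdQ x : @cyl_bd R n x -> ([set x | x.2 = itv0 R] `|` range (@lid R n)) x.
  by case/lid_cover => [|[z <-]]; [left|right; exists z].
have [w' [cw' w'Q pw']] := acyclic_pair ap (@cyl_disc_pair R n)
  (continuous_subspaceW bdQ cw) cv (fun x Qx => pw x (bdQ x Qx)).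
exists w'; split => // z; rewrite w'Q; last by constructor 2.
by rewrite wQ.
Qed.

Lemma acyclic_fibration (E B : cgTop) (p : cgMap E B) : acyclic p -> fibration R p.
Proof.
move=> ap _ _ _ [n] u v uv.
have [w [cw w0 pw]] := @acyclic_cylinder E B p n (fun z => u (Some z))
  (fun x => v (Some x)) ap
  (comp_continuous (@Some_continuous _) (@cg_continuous _ _ u))
  (comp_continuous (@Some_continuous _) (@cg_continuous _ _ v))
  (fun z => congr1 (fun h : cgMap (plus (D n)) B => h (Some z)) uv).
exists (@plus_cg (cylinder R n) E w cw); split; apply: cgMap_eq => -[x|] /=.
- exact: w0.
- by rewrite (cg_pointed u).
- exact: pw.
- by rewrite !cg_pointed.
Qed.

Lemma spheroid_bd (X : topologicalType) (n : nat) (x : X) (a : D n -> X) :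
  spheroid x a <-> continuous a /\ forall z, bd z -> a z = x.
Proof.
split=> -[ca ax]; split => //; last by move=> v; apply: ax; exact: bd_sphere_incl.
by move=> z bz; rewrite -(bd_pointK bz).
Qed.

Lemma cylinder_end_continuous (X : topologicalType) (n : nat) (H : cylinder R n -> X) (t : I) :
  continuous H -> continuous (fun z => H (z, t)).
Proof.
apply: comp_continuous; apply: pair_continuous; first exact: idfun_continuous.
exact: cst_continuous.
Qed.

Lemma bottom_neq_top : itv0 R <> itv1 R.
Proof.
move=> /(congr1 (fun t : I => set_val t)); rewrite val_itv0 val_itv1.
by move/eqP; rewrite eq_sym oner_eq0.
Qed.

Lemma bd_cyl_closed (n : nat) : closed [set x : cylinder R n | bd x.1].
Proof.
have /continuous_closedP := @fst_continuous (D n) I.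
by move=> /(_ _ (@bd_closed R n)).
Qed.

Lemma top_closed (n : nat) : closed [set x : cylinder R n | x.2 = itv1 R].
Proof.
have /continuous_closedP := @snd_continuous (D n) I.
move=> /(_ [set itv1 R]); apply.
by apply: compact_closed; [exact: ch_hausdorff|exact: compact_set1].
Qed.

Lemma cyl_bd_glue (X : topologicalType) (n : nat) (b t s : cylinder R n -> X) :
  continuous b -> continuous t ->
  {within [set x | bd x.1], continuous s} ->
  (forall z, bd z -> s (z, itv0 R) = b (z, itv0 R)) ->
  (forall z, bd z -> s (z, itv1 R) = t (z, itv1 R)) ->
  exists U : cylinder R n -> X,
    [/\ {within @cyl_bd R n, continuous U}, forall z, U (z, itv0 R) = b (z, itv0 R),
        forall z, U (z, itv1 R) = t (z, itv1 R) & forall z y, bd z -> U (z, y) = s (z, y)].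
Proof.
move=> cb ct cs sb st.
pose U (x : cylinder R n) := if pselect (x.2 = itv0 R) then b x else
  if pselect (x.2 = itv1 R) then t x else s x.
have U0 x : x.2 = itv0 R -> U x = b x by rewrite /U; case: pselect.
have U1 x : x.2 = itv1 R -> U x = t x.
  move=> e1; rewrite /U; case: pselect => [e0|_] /=; last by case: (pselect (x.2 = itv1 R)).
  by exfalso; exact: bottom_neq_top (etrans (esym e0) e1).
have Us x : bd x.1 -> U x = s x.
  case: x => z y /= bz; have [e|n0] := pselect (y = itv0 R).
    by rewrite U0// e sb.
  have [e|n1] := pselect (y = itv1 R); first by rewrite U1// e st.
  by rewrite /U; case: pselect => //; case: pselect.
exists U; split => [|z|z|z y bz]; [|exact: U0|exact: U1|exact: Us].
have -> : @cyl_bd R n = [set x | bd x.1] `|`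
    ([set x | x.2 = itv0 R] `|` [set x | x.2 = itv1 R]).
  apply/seteqP; split => x.
    by case=> ?; [left|right; left|right; right].
  by case=> [?|[]?]; [constructor 1|constructor 2|constructor 3].
apply: withinU_continuous.
- exact: bd_cyl_closed.
- by apply: closedU; [exact: bottom_closed|exact: top_closed].
- by apply: within_eq cs _ => x /= /Us.
- apply: withinU_continuous; [exact: bottom_closed|exact: top_closed| |].
  + by apply: (within_eq (f := b)); [exact: continuous_subspaceT|move=> x /= /U0].
  + by apply: (within_eq (f := t)); [exact: continuous_subspaceT|move=> x /= /U1].
Qed.

(** Spheroids and homotopies in [Y] are lifted through [p], with boundary values
in the image of [j], and pushed back to [X] by [r]; the homotopy [th] compares the
result with the original. Apart from [p] being acyclic, all the data are
preserved by mapping space functors, which is how the lemma is used. *)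
Lemma weak_equivalence_factor (X N Y : cgTop) (g : cgMap X Y) (p : cgMap N Y)
    (j : cgMap X N) (r : cgMap N X) (th : N -> I -> Y) :
  acyclic p -> (forall x, r (j x) = x) -> (forall x, p (j x) = g x) ->
  (forall n, th n (itv0 R) = g (r n)) -> (forall n, th n (itv1 R) = p n) ->
  (forall x t, th (j x) t = g x) ->
  (forall (C : topologicalType) (s : C -> N) (t : C -> I),
     test_map s -> test_map t -> continuous (fun c => th (s c) (t c))) ->
  weak_equivalence R g.
Proof.
move=> ap rj pj th0 th1 thj cth n x; split.
- move=> b /spheroid_bd [cb bx].
  have [|w [cw wj pw]] := ap n (fun=> j x) b
      (continuous_subspaceT (@cst_continuous _ _ _)) cb.
    by move=> z bz; rewrite pj bx.
  exists (fun z => r (w z)).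
    apply/spheroid_bd; split; first exact: (comp_continuous cw (@cg_continuous _ _ r)).
    by move=> z bz; rewrite wj.
  exists (fun x => th (w x.1) x.2); split => /=.
  + apply: cth; split.
    * exact: (@ch_compact (cylinder R n)).
    * exact: (@ch_hausdorff (cylinder R n)).
    * exact: (comp_continuous (@fst_continuous _ _) cw).
    * exact: (@ch_compact (cylinder R n)).
    * exact: (@ch_hausdorff (cylinder R n)).
    * exact: snd_continuous.
  + by move=> z; rewrite th0.
  + by move=> z; rewrite th1.
  + by move=> v t; rewrite wj ?rj ?thj//; exact: bd_sphere_incl.
- move=> a a' /spheroid_bd [ca ax] /spheroid_bd [ca' ax'] [L [cL L0 L1 Ls]].
  have ca1 : continuous (fun x : cylinder R n => j (a x.1)).
    apply: (comp_continuous _ (@cg_continuous _ _ j)).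
    exact: (comp_continuous (@fst_continuous _ _) ca).
  have ca1' : continuous (fun x : cylinder R n => j (a' x.1)).
    apply: (comp_continuous _ (@cg_continuous _ _ j)).
    exact: (comp_continuous (@fst_continuous _ _) ca').
  have [||U [cU U0 U1 Us]] := cyl_bd_glue ca1 ca1'
      (continuous_subspaceT (@cst_continuous _ _ (j x))).
  + by move=> z bz /=; rewrite ax.
  + by move=> z bz /=; rewrite ax'.
  have [|W [cW WU pW]] := acyclic_pair ap (@cyl_disc_pair R n) cU cL.
    case=> z t /= [/= bz|/= ->|/= ->].
    * rewrite Us// pj -[in RHS](bd_pointK bz) Ls /= bd_pointK.
      by rewrite ax.
    * by rewrite U0 pj L0.
    * by rewrite U1 pj L1.
  exists (fun x => r (W x)); split.
  + exact: (comp_continuous cW (@cg_continuous _ _ r)).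
  + by move=> z; rewrite WU ?U0 ?rj//; constructor 2.
  + by move=> z; rewrite WU ?U1 ?rj//; constructor 3.
  + move=> v t; rewrite WU; last by constructor 1; exact: bd_sphere_incl.
    by rewrite Us ?rj ?ax//; exact: bd_sphere_incl.
Qed.

Lemma acyclic_weak_equivalence (X Y : cgTop) (p : cgMap X Y) :
  acyclic p -> weak_equivalence R p.
Proof.
move=> ap; apply: (@weak_equivalence_factor X X Y p p (cg_id X) (cg_id X)
  (fun x _ => p x)) => // C s t [_ _ cs] _.
exact: (comp_continuous cs (@cg_continuous _ _ p)).
Qed.

End acyclic_maps.

(** * The path fibration of a weak equivalence is acyclic *)

Section path_fibration.
Context (R : realType).

Notation D n := (disc R n).
Notation I := (unit_interval R).

Lemma within_range (C P X : topologicalType) (phi : C -> P) (f : P -> X) :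
  compact [set: C] -> hausdorff_space P -> continuous phi ->
  continuous (fun c => f (phi c)) -> {within range phi, continuous f}.
Proof.
move=> cC hP cphi cf.
have [|c //|c c' _ e|w [cw _ wf]] := @compact_glue C P X phi set0 f
  (fun c => f (phi c)) cC hP cphi (@closed0 _) _ cf.
- exact: continuous_subspace0.
- by rewrite e.
- rewrite set0U in cw; apply: within_eq cw _ => _ [c _ <-]; exact: wf.
Qed.

Lemma clip_ray (n : nat) (z : D n) (c : R) :
  bd z -> 1 <= c -> clip (c *: set_val z) = z.
Proof.
move=> bz c1; have c0 : 0 <= c by lra.
have n1 : nrm (c *: set_val z) = c by rewrite nrmZ_ge0// [nrm _]bz mulr1.
apply: disc_val_inj; rewrite val_clip_out n1// scalerA mulVf ?scale1r//.
by rewrite gt_eqF//; lra.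
Qed.

Lemma nrm_ray (n : nat) (z : D n) (c : R) : bd z -> 0 <= c -> nrm (c *: set_val z) = c.
Proof. by move=> bz c0; rewrite nrmZ_ge0// [nrm _]bz mulr1. Qed.

Section extension_over_disc.
Context (X Y : cgTop) (g : cgMap X Y) (we : weak_equivalence R g).

Let poleD (m : nat) : D m.+1 := sphere_incl (pole R m).

(** The map [u] on the sphere, precomposed with the collapse of the disc of one
dimension less, is a spheroid; its image in [Y] contracts inside the disc filled
by [G], each point moving to the pole on a straight line. Injectivity of [g] on
homotopy groups contracts the spheroid in [X], and the contraction fills the disc
when its time is read as the distance to the sphere. *)
Lemma extension_over_disc (m : nat) (u : D m.+1 -> X) (G : D m.+1 -> Y) :
  {within @bd R m.+1, continuous u} -> continuous G ->
  (forall z, bd z -> g (u z) = G z) ->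
  exists w : D m.+1 -> X, continuous w /\ forall z, bd z -> w z = u z.
Proof.
move=> cu cG gu.
pose c (z : D m) : D m.+1 := sphere_incl (collapse z).
have cc : continuous c.
  exact: (comp_continuous (@collapse_continuous R m) (@sphere_incl_continuous R m.+1)).
have bc z : bd (c z) by exact: bd_sphere_incl.
have bp : bd (poleD m) by exact: bd_sphere_incl.
have cpole z : bd z -> c z = poleD m by rewrite /c => /collapse_pole ->.
pose x : X := u (poleD m).
have ca : continuous (fun z => u (c z)).
  apply/continuous_subspace_setT; apply: (within_comp (A := @bd R m.+1)) => //.
  exact: continuous_subspaceT.
have sa : spheroid x (fun z => u (c z)).
  by apply/spheroid_bd; split => // z /cpole ->.
have sx : spheroid x (fun _ : D m => x).
  by apply/spheroid_bd; split => [|//]; exact: cst_continuous.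
have [K [cK K0 K1 Ks]] : rel_homotopic (fun z => u (c z)) (fun _ : D m => x).
  apply: (we m x).2 => //.
  exists (fun y : cylinder R m => G (clip ((1 - set_val y.2) *: set_val (c y.1)
                                  + set_val y.2 *: set_val (poleD m)))).
  split.
  - apply: comp_continuous cG; apply: continuous_clip.
    have c2 : continuous (fun y : cylinder R m => set_val y.2 : R).
      exact: (comp_continuous (@snd_continuous _ _) (@itv_val_continuous R)).
    apply: continuous_addV; apply: continuous_scale => //.
    + apply: continuous_addr; first exact: cst_continuous.
      exact: continuous_oppr.
    + apply: comp_continuous (@disc_val_continuous R m.+1).
      exact: (comp_continuous (@fst_continuous _ _) cc).
    + exact: cst_continuous.
  - by move=> z /=; rewrite val_itv0 subr0 scale1r scale0r addr0 clipK gu.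
  - by move=> z /=; rewrite val_itv1 subrr scale1r scale0r add0r clipK gu.
  - move=> v t /=; rewrite cpole; last exact: bd_sphere_incl.
    by rewrite -scalerDl subrK scale1r clipK gu.
have Kbd z t : bd z -> K (z, t) = x.
  by move=> bz; rewrite -(bd_pointK bz) Ks bd_pointK cpole.
pose phi (y : cylinder R m) : D m.+1 := clip ((1 - set_val y.2) *: set_val (c y.1)).
have t1 (t : I) : 0 <= 1 - set_val t by rewrite subr_ge0 itv_le1.
have nphi (y : cylinder R m) : nrm ((1 - set_val y.2) *: set_val (c y.1)) = 1 - set_val y.2.
  exact: nrm_ray.
have vphi (y : cylinder R m) : set_val (phi y) = (1 - set_val y.2) *: set_val (c y.1).
  by rewrite val_clip_id// nphi; have := itv_ge0 y.2; lra.
have cphi : continuous phi.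
  apply: continuous_clip; apply: continuous_scale.
    apply: continuous_addr; first exact: cst_continuous.
    apply: continuous_oppr.
    exact: (comp_continuous (@snd_continuous _ _) (@itv_val_continuous R)).
  apply: comp_continuous (@disc_val_continuous R m.+1).
  exact: (comp_continuous (@fst_continuous _ _) cc).
pose ray (s : I) : D m.+1 := clip (set_val s *: set_val (poleD m)).
have vray (s : I) : set_val (ray s) = set_val s *: set_val (poleD m).
  by rewrite val_clip_id// nrm_ray ?itv_le1// itv_ge0.
have nray (s : I) : nrm (set_val (ray s)) = set_val s by rewrite vray nrm_ray ?itv_ge0.
(* For m = 0 the collapse misses the pole, so the ray to it is added by hand. *)
have clQ : closed (range ray).
  apply: compact_closed; first exact: disc_hausdorff.
  apply: continuous_compact; last exact: ch_compact.
  apply: continuous_subspaceT; apply: continuous_clip; apply: continuous_scale.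
    exact: itv_val_continuous.
  exact: cst_continuous.
have K1x (y : cylinder R m) : 1 - set_val y.2 = 0 -> K y = x.
  case: y => z t /= e; have -> : t = itv1 R; last exact: K1.
  by apply: itv_val_inj; rewrite val_itv1; lra.
have [w [cw wQ wphi]] : exists w : D m.+1 -> X,
    [/\ {within range ray `|` range phi, continuous w},
        forall y, range ray y -> w y = x & forall y, w (phi y) = K y].
  have cx : {within range ray, continuous (fun _ : D m.+1 => x)}.
    by apply: continuous_subspaceT; exact: cst_continuous.
  apply: (@compact_glue (cylinder R m) (D m.+1) X phi (range ray) (fun=> x) K
    (@ch_compact (cylinder R m)) (@disc_hausdorff R m.+1) cphi clQ cx cK).
  - move=> y [s _ e]; have := nray s; rewrite e vphi nphi => es.
    have [/K1x //|/eqP ne] := eqVneq (1 - set_val y.2) 0.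
    move: (vray s); rewrite e vphi -es => /scalerI; move/eqP: ne => ne /(_ ne) ec.
    have /collapse_pole bz : collapse y.1 = pole R m.
      by apply: sphere_incl_inj; apply: disc_val_inj.
    by rewrite [y]surjective_pairing Kbd.
  - move=> y y' _ e.
    have es : 1 - set_val y.2 = 1 - set_val y'.2 by rewrite -nphi -vphi e vphi nphi.
    have [e0|ne] := eqVneq (1 - set_val y.2) 0; first by rewrite !K1x// -es.
    have et : y.2 = y'.2 by apply: itv_val_inj; lra.
    have : set_val (phi y) = set_val (phi y') by rewrite e.
    rewrite !vphi -es => /(scalerI ne) /disc_val_inj/sphere_incl_inj/collapse_inj.
    case=> [ez|[b b']].
      by rewrite [y]surjective_pairing [y']surjective_pairing ez et.
    by rewrite [y]surjective_pairing [y']surjective_pairing !Kbd.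
have cover (y : D m.+1) : (range ray `|` range phi) y.
  have [y0|y0] := eqVneq (nrm (set_val y)) 0.
    left; exists (itv0 R) => //; apply: disc_val_inj.
    by rewrite vray val_itv0 scale0r (nrm_eq0 y0).
  have yp : 0 < nrm (set_val y) by rewrite lt_neqAle eq_sym y0 nrm_ge0.
  pose y' := (nrm (set_val y))^-1 *: set_val y.
  have ny' : nrm y' = 1 by rewrite nrmZ_ge0 ?invr_ge0 ?nrm_ge0// mulVf.
  have vy' : set_val (clip y') = y' by rewrite val_clip_id// ny'.
  have by' : bd (clip y') by rewrite /bd /= vy'.
  have yE : set_val y = nrm (set_val y) *: y' by rewrite scalerA mulfV// scale1r.
  have y1 := disc_le1 y.
  have [e|/collapse_surj [z ez]] := pselect (bd_point by' = pole R m).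
    left; exists (clipI (nrm (set_val y))) => //; apply: disc_val_inj.
    by rewrite vray val_clipI_id ?nrm_ge0// /poleD -e bd_pointK vy' -yE.
  right; exists (z, clipI (1 - nrm (set_val y))) => //; apply: disc_val_inj.
  rewrite vphi /c ez bd_pointK vy' val_clipI_id; last 2 first.
  - by lra.
  - by lra.
  by rewrite (_ : 1 - _ = nrm (set_val y)); [rewrite -yE|lra].
exists w; split.
  apply/continuous_subspace_setT; rewrite (_ : setT = range ray `|` range phi) //.
  by apply/seteqP; split => // y _; exact: cover.
move=> y by_; have [e|/collapse_surj [z ez]] := pselect (bd_point by_ = pole R m).
  have yp : y = poleD m by rewrite /poleD -e bd_pointK.
  rewrite wQ ?yp//; exists (itv1 R) => //; apply: disc_val_inj.
  by rewrite vray val_itv1 scale1r.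
have cz : c z = y by rewrite /c ez bd_pointK.
rewrite -[in LHS]cz -cz -K0 -wphi; congr w; apply: disc_val_inj.
by rewrite vphi /= val_itv0 subr0 scale1r.
Qed.

End extension_over_disc.

(** The disc of radius 1/2 carries [v], and the collar around it runs through the
homotopy [u]. *)
Lemma homotopy_extension_disc (n : nat) (Y : topologicalType) (v : D n -> Y)
    (u : D n * I -> Y) :
  continuous v -> {within [set x | bd x.1], continuous u} ->
  (forall z, bd z -> u (z, itv0 R) = v z) ->
  exists w : D n -> Y, continuous w /\ forall z, bd z -> w z = u (z, itv1 R).
Proof.
move=> cv cu uv.
have n2 (z : D n) : nrm (2 *: set_val z) = 2 * nrm (set_val z) by rewrite nrmZ_ge0.
have c2 : continuous (fun z : D n => clip (2 *: set_val z)).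
  apply: continuous_clip; apply: continuous_scale; first exact: cst_continuous.
  exact: disc_val_continuous.
have cn : continuous (fun z : D n => 2 * nrm (set_val z)).
  apply: continuous_mulr; first exact: cst_continuous.
  by apply: continuous_nrm; exact: disc_val_continuous.
exists (fun z => if 2 * nrm (set_val z) <= 1 then v (clip (2 *: set_val z)) else
  u (clip (2 *: set_val z), clipI (2 * nrm (set_val z) - 1))); split.
  apply: continuous_if => //.
  - by apply: continuous_subspaceT; exact: comp_continuous c2 cv.
  - apply: (within_comp (A := [set x | bd x.1])) cu.
      apply: continuous_subspaceT; apply: pair_continuous => //.
      apply: continuous_clipI; apply: continuous_addr => //.
      exact: cst_continuous.
    by move=> z /= h; apply: bd_clip; rewrite n2.
  - move=> z e; rewrite e subrr clipI0 uv//; apply: bd_clip.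
    by rewrite n2 e.
move=> z bz; rewrite [nrm _]bz mulr1 ifF; last by apply/negbTE; rewrite -ltNge; lra.
rewrite clip_ray//; last by lra.
by congr (u (_, _)); rewrite (_ : 2 - 1 = 1) ?clipI1//; lra.
Qed.

Lemma homotopy_extension (n : nat) (P Y : topologicalType) (Q : set P) (F : P -> Y)
    (u : P * I -> Y) :
  disc_pair R n Q -> continuous F -> {within [set x | Q x.1], continuous u} ->
  (forall x, Q x -> u (x, itv0 R) = F x) ->
  exists w : P -> Y, continuous w /\ forall x, Q x -> w x = u (x, itv1 R).
Proof.
move=> [f [h [cf ch fK hK fbd]]] cF cu uF.
have [|||w [cw wu]] := @homotopy_extension_disc n Y (fun z => F (f z))
    (fun x => u (f x.1, x.2)).
- exact: comp_continuous.
- apply: (within_comp (A := [set x | Q x.1])) cu => //.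
    apply: continuous_subspaceT; apply: pair_continuous; last exact: snd_continuous.
    exact: (comp_continuous (@fst_continuous _ _) cf).
  by move=> x /= /fbd.
- by move=> z /fbd; exact: uF.
exists (fun x => w (h x)); split; first exact: comp_continuous.
by move=> x Qx; rewrite wu ?hK//; apply/fbd; rewrite hK.
Qed.

End path_fibration.

Section homotopy_lifting.
Context (R : realType) (X Y : cgTop) (g : cgMap X Y) (we : weak_equivalence R g).

Notation D n := (disc R n).
Notation I := (unit_interval R).

Section concatenation.
Context (k : nat).
Notation V := 'rV[R]_k.

(** Concatenation along rays: [a] on the unit disc, then [e] from its centre
outwards. *)
Definition out_from (Z : Type) (a e : D k -> Z) (z : V) : Z :=
  if nrm z <= 1 then a (clip z) else e (clip ((nrm z - 1) *: set_val (clip z))).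

Lemma continuous_ray (f : V -> R) :
  continuous f -> continuous (fun z : V => clip (f z *: set_val (clip z))).
Proof.
move=> cf; apply: continuous_clip; apply: continuous_scale => //.
exact: (comp_continuous (@clip_continuous R k) (@disc_val_continuous R k)).
Qed.

Lemma continuous_nrm_id : continuous (fun z : V => nrm z).
Proof. by apply: continuous_nrm; exact: idfun_continuous. Qed.

Lemma out_from_continuous (Z : topologicalType) (a e : D k -> Z) :
  continuous a -> continuous e -> (forall z, bd z -> a z = e (clip 0)) ->
  continuous (out_from a e).
Proof.
move=> ca ce ae; apply: continuous_if; first exact: continuous_nrm_id.
- by apply: continuous_subspaceT; exact: (comp_continuous (@clip_continuous R k) ca).
- apply: continuous_subspaceT; apply: (comp_continuous _ ce); apply: continuous_ray.
  apply: continuous_addr; first exact: continuous_nrm_id.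
  exact: cst_continuous.
- by move=> z z1; rewrite z1 subrr scale0r ae//; apply: bd_clip; rewrite z1.
Qed.

(** The three layers [v], [h] with reversed time, [e] from the outside inwards,
on the discs of radius 1, 2, 3. *)
Definition in_from (Z : Type) (v : D k -> Z) (h : cylinder R k -> Z) (e : D k -> Z)
    (z : V) : Z :=
  if nrm z <= 1 then v (clip z) else
  if nrm z <= 2 then h (clip z, clipI (2 - nrm z)) else
  e (clip ((3 - nrm z) *: set_val (clip z))).

Lemma in_from_continuous (Z : topologicalType) (v : D k -> Z)
    (h : cylinder R k -> Z) (e : D k -> Z) :
  continuous v -> {within [set x | bd x.1], continuous h} -> continuous e ->
  (forall z, bd z -> h (z, itv1 R) = v z) -> (forall z, bd z -> h (z, itv0 R) = e z) ->
  continuous (in_from v h e).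
Proof.
move=> cv ch ce hv he; apply: continuous_if; first exact: continuous_nrm_id.
- by apply: continuous_subspaceT; exact: (comp_continuous (@clip_continuous R k) cv).
- apply: within_if; [|exact: continuous_nrm_id| | |].
  + by have /continuous_closedP := continuous_nrm_id => /(_ _ (@closed_ge R 1)).
  + apply: (within_comp (A := [set x | bd x.1])) ch; last first.
      by move=> z [z1 _]; exact: bd_clip.
    apply: continuous_subspaceT; apply: pair_continuous; first exact: clip_continuous.
    apply: continuous_clipI; apply: continuous_addr; first exact: cst_continuous.
    by apply: continuous_oppr; exact: continuous_nrm_id.
  + apply: continuous_subspaceT; apply: (comp_continuous _ ce); apply: continuous_ray.
    apply: continuous_addr; first exact: cst_continuous.
    by apply: continuous_oppr; exact: continuous_nrm_id.
  + move=> z z1 z2; have e0 : 2 - nrm z = 0 by lra.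
    have e1 : 3 - nrm z = 1 by lra.
    have bz : bd (clip z) by apply: bd_clip; rewrite z2; lra.
    by rewrite e0 e1 clipI0 he// scale1r clipK.
- move=> z z1; have e1 : 2 - nrm z = 1 by lra.
  have bz : bd (clip z) by apply: bd_clip; rewrite z1.
  rewrite ifT; last by rewrite z1; lra.
  by rewrite e1 clipI1 hv.
Qed.

Lemma out_from_in (Z : Type) (a e : D k -> Z) (z : D k) : out_from a e (set_val z) = a z.
Proof. by rewrite /out_from disc_le1 clipK. Qed.

Lemma out_from_ray (Z : Type) (a e : D k -> Z) (z : D k) (c : R) :
  (forall z, bd z -> a z = e (clip 0)) ->
  bd z -> 1 <= c -> out_from a e (c *: set_val z) = e (clip ((c - 1) *: set_val z)).
Proof.
move=> ae bz c1; rewrite /out_from nrm_ray//; last by lra.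
rewrite clip_ray//; case: ifP => // c1'; have e0 : c - 1 = 0 by lra.
by rewrite e0 scale0r ae.
Qed.

Lemma in_from_in (Z : Type) (v : D k -> Z) (h : cylinder R k -> Z) (e : D k -> Z) (z : D k) :
  in_from v h e (set_val z) = v z.
Proof. by rewrite /in_from disc_le1 clipK. Qed.

Lemma in_from_mid (Z : Type) (v : D k -> Z) (h : cylinder R k -> Z) (e : D k -> Z)
    (z : D k) (t : I) : (forall z, bd z -> h (z, itv1 R) = v z) ->
  bd z -> in_from v h e ((2 - set_val t) *: set_val z) = h (z, t).
Proof.
move=> hv bz; have t0 := itv_ge0 t; have t1 := itv_le1 t.
have c1 : 1 <= 2 - set_val t by lra.
rewrite /in_from nrm_ray//; last by lra.
rewrite clip_ray//; case: ifP => h1.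
  have -> : t = itv1 R by apply: itv_val_inj; rewrite val_itv1; lra.
  by rewrite hv.
rewrite ifT; last by lra.
by congr (h (_, _)); apply: itv_val_inj; rewrite val_clipI_id; lra.
Qed.

Lemma in_from_ray (Z : Type) (v : D k -> Z) (h : cylinder R k -> Z) (e : D k -> Z)
    (z : D k) (c : R) :
  (forall z, bd z -> h (z, itv0 R) = e z) ->
  bd z -> 2 <= c -> in_from v h e (c *: set_val z) = e (clip ((3 - c) *: set_val z)).
Proof.
move=> he bz c2; have c1 : 1 <= c by lra.
rewrite /in_from nrm_ray//; last by lra.
rewrite clip_ray// ifF; last by apply/negbTE; rewrite -ltNge; lra.
case: ifP => // c2'; have e0 : 2 - c = 0 by lra.
have e1 : 3 - c = 1 by lra.
by rewrite e0 e1 clipI0 he// scale1r clipK.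
Qed.

End concatenation.

Lemma extension (k : nat) (u : D k -> X) (G : D k -> Y) :
  {within @bd R k, continuous u} -> continuous G -> (forall z, bd z -> g (u z) = G z) ->
  exists w : D k -> X, continuous w /\ forall z, bd z -> w z = u z.
Proof.
case: k u G => [|m] u G cu cG gu; last exact: extension_over_disc cu cG gu.
exists (fun=> point); split; first exact: cst_continuous.
move=> z; rewrite /bd /= => bz; exfalso.
have : set_val z = 0 by apply/rowP => -[].
by move=> e; move: bz; rewrite e nrm0 => /eqP; rewrite eq_sym oner_eq0.
Qed.

(** First [u] extends to a disc [e] in [X]. The sphere made of [v], [h] and
[g e] is a spheroid in [Y], hence homotopic to the image of a spheroid [a] of
[X]; adding [a] to [e] gives [w]. The homotopy from [g w] to [v] comes from the
one between the two spheroids: let [s] run from 0 to 2; for [s <= 1] the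
rays of [e] are uncovered on the bottom and cancelled on the top, and for
[s >= 1] the layer [h] is moved from the top to the side. This moves the
boundary values of a map on the cylinder, and the homotopy extension property
moves the map. *)
Lemma homotopy_extension_lifting (k : nat) (u : D k -> X) (h : cylinder R k -> Y)
    (v : D k -> Y) :
  {within @bd R k, continuous u} -> {within [set x | bd x.1], continuous h} ->
  continuous v ->
  (forall z, bd z -> h (z, itv0 R) = g (u z)) -> (forall z, bd z -> h (z, itv1 R) = v z) ->
  exists (w : D k -> X) (H : cylinder R k -> Y),
    [/\ continuous w /\ continuous H, forall z, bd z -> w z = u z,
        forall z t, bd z -> H (z, t) = h (z, t),
        forall z, H (z, itv0 R) = g (w z) & forall z, H (z, itv1 R) = v z].
Proof.
move=> cu ch cv hu hv.
have c2 (c : R) : continuous (fun z : D k => c *: set_val z).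
  by apply: continuous_scale; [exact: cst_continuous|exact: disc_val_continuous].
have [e [ce eu]] : exists e : D k -> X, continuous e /\ forall z, bd z -> e z = u z.
  (* [v] on the disc of radius 1/2, and [h] from its top to its bottom on the
     collar: a filling in [Y] of the sphere [g u]. *)
  have chv : continuous (fun z : D k => if 2 * nrm (set_val z) <= 1
      then v (clip (2 *: set_val z))
      else h (clip (2 *: set_val z), clipI (2 - 2 * nrm (set_val z)))).
    have n2 (z : D k) : nrm (2 *: set_val z) = 2 * nrm (set_val z) by rewrite nrmZ_ge0.
    have cn : continuous (fun z : D k => 2 * nrm (set_val z)).
      apply: continuous_mulr; first exact: cst_continuous.
      by apply: continuous_nrm; exact: disc_val_continuous.
    apply: continuous_if => //.
    - by apply: continuous_subspaceT; exact: comp_continuous (continuous_clip (c2 2)) cv.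
    - apply: (within_comp (A := [set x | bd x.1])) ch.
        apply: continuous_subspaceT; apply: pair_continuous; first exact: continuous_clip.
        apply: continuous_clipI; apply: continuous_addr; first exact: cst_continuous.
        exact: continuous_oppr.
      by move=> z /= h1; apply: bd_clip; rewrite n2.
    - move=> z e; have e1 : 2 - 2 * nrm (set_val z) = 1 by lra.
      by rewrite e1 clipI1 hv//; apply: bd_clip; rewrite n2 e.
  apply: extension cu chv _ => z bz.
  have n1 : nrm (set_val z) = 1 by exact: bz.
  have e0 : 2 - 2 * nrm (set_val z) = 0 by lra.
  have l2 : (1 : R) <= 2 by lra.
  rewrite ifF; last by apply/negbTE; rewrite -ltNge n1; lra.
  by rewrite e0 clipI0 clip_ray// hu.
pose x := e (clip 0).
have cge : continuous (fun z => g (e z)) := comp_continuous ce (@cg_continuous _ _ g).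
have he z : bd z -> h (z, itv0 R) = g (e z) by move=> bz; rewrite hu// eu.
pose bb : 'rV[R]_k -> Y := in_from v h (fun z => g (e z)).
have cbb : continuous bb by exact: in_from_continuous.
have sb : spheroid (g x) (fun z : D k => bb (3 *: set_val z)).
  apply/spheroid_bd; split; first exact: comp_continuous cbb.
  have l3 : (2 : R) <= 3 by lra.
  by move=> z bz; rewrite /bb in_from_ray// subrr scale0r.
have [a /spheroid_bd [ca ax] [M [cM M0 M1 Ms]]] := (we k x).1 _ sb.
pose aa : 'rV[R]_k -> X := out_from a e.
have caa : continuous aa by exact: out_from_continuous.
(* The parameter of the deformation is [s = 2 * y.2]; [mu = min(s, 1)] measures
   its first stage and [nu = max(s - 1, 0)] the second. *)
pose mu (y : cylinder R k * I) : R := Num.min (2 * set_val y.2) 1.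
pose nu (y : cylinder R k * I) : R := Num.max (2 * set_val y.2 - 1) 0.
have c2s : continuous (fun y : cylinder R k * I => 2 * set_val y.2 : R).
  apply: continuous_mulr; first exact: cst_continuous.
  exact: (comp_continuous (@snd_continuous _ _) (@itv_val_continuous R)).
have cmu : continuous mu by apply: continuous_minr => //; exact: cst_continuous.
have cnu : continuous nu.
  apply: continuous_maxr; last exact: cst_continuous.
  by apply: continuous_addr => //; exact: cst_continuous.
have mu01 y : 0 <= mu y <= 1.
  by rewrite /mu le_min ge_min lexx orbT ler01 !andbT mulr_ge0// itv_ge0.
have cz : continuous (fun y : cylinder R k * I => set_val y.1.1).
  apply: (comp_continuous _ (@disc_val_continuous R k)).
  exact: (comp_continuous (@fst_continuous _ _) (@fst_continuous _ _)).
have ct : continuous (fun y : cylinder R k * I => set_val y.1.2 : R).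
  apply: (comp_continuous _ (@itv_val_continuous R)).
  exact: (comp_continuous (@fst_continuous _ _) (@snd_continuous _ _)).
(* The side formula also gives the values at the top, where [t = 1]. *)
pose bot (y : cylinder R k * I) : Y := g (aa ((1 + mu y) *: set_val y.1.1)).
pose sid (y : cylinder R k * I) : Y :=
  bb ((3 - mu y - set_val y.1.2 * nu y) *: set_val y.1.1).
have cbot : continuous bot.
  apply: (comp_continuous _ (@cg_continuous _ _ g)); apply: (comp_continuous _ caa).
  by apply: continuous_scale => //; apply: continuous_addr => //; exact: cst_continuous.
have csid : continuous sid.
  apply: (comp_continuous _ cbb); apply: continuous_scale => //.
  apply: continuous_addr; last by apply: continuous_oppr; exact: continuous_mulr.
  by apply: continuous_addr; [exact: cst_continuous|exact: continuous_oppr].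
pose U y := if pselect (y.1.2 = itv0 R) then bot y else sid y.
have U0 y : y.1.2 = itv0 R -> U y = bot y by rewrite /U; case: pselect.
have bs y : bd y.1.1 -> y.1.2 = itv0 R -> bot y = sid y.
  move=> bz t0; rewrite /bot /sid t0 val_itv0 mul0r subr0 /aa /bb.
  have := mu01 y; move: (mu y) => m /andP[m0 m1].
  have h1 : 1 <= 1 + m by lra.
  have h2 : 2 <= 3 - m by lra.
  rewrite out_from_ray// in_from_ray//.
  by have -> : 3 - (3 - m) = 1 + m - 1 by lra.
have U1 y : bd y.1.1 \/ y.1.2 = itv1 R -> U y = sid y.
  rewrite /U; case: pselect => // t0 [bz|t1]; first exact: bs.
  by exfalso; exact: (@bottom_neq_top R (etrans (esym t0) t1)).
have cU : {within [set y | @cyl_bd R k y.1], continuous U}.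
  have -> : [set y | @cyl_bd R k y.1] =
      [set y : cylinder R k * I | y.1.2 = itv0 R] `|`
      [set y | ([set p : cylinder R k | bd p.1] `|` [set p | p.2 = itv1 R]) y.1].
    apply/seteqP; split => y.
      by case=> ?; [right; left|left|right; right].
    by case=> [?|[]?]; [constructor 2|constructor 1|constructor 3].
  apply: withinU_continuous.
  - have /continuous_closedP := @fst_continuous (cylinder R k) I.
    by move=> /(_ _ (@bottom_closed R k)).
  - have /continuous_closedP := @fst_continuous (cylinder R k) I.
    by move=> /(_ _ (closedU (@bd_cyl_closed R k) (@top_closed R k))).
  - by apply: (within_eq (f := bot)); [exact: continuous_subspaceT|move=> y /= /U0].
  - by apply: (within_eq (f := sid)); [exact: continuous_subspaceT|move=> y /= /U1].
have mu_start p : mu (p, itv0 R) = 0 by rewrite /mu val_itv0 mulr0 (min_idPl _).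
have nu_start p : nu (p, itv0 R) = 0 by rewrite /nu val_itv0 mulr0 (max_idPr _)//; lra.
have mu_end p : mu (p, itv1 R) = 1 by rewrite /mu val_itv1 mulr1 (min_idPr _)//; lra.
have nu_end p : nu (p, itv1 R) = 1 by rewrite /nu val_itv1 mulr1 (max_idPl _); lra.
have [|H [cH HU]] := homotopy_extension (@cyl_disc_pair R k) cM cU.
  case=> z t [/= bz|/= ->|/= ->].
  - rewrite U1; last by left.
    rewrite /sid mu_start nu_start mulr0 !subr0 -[in RHS](bd_pointK bz) Ms bd_pointK.
    have l3 : (2 : R) <= 3 by lra.
    by rewrite /= ax// /bb in_from_ray// subrr scale0r.
  - rewrite U0// /bot mu_start addr0 scale1r M0 /=.
    by rewrite /aa out_from_in.
  - rewrite U1; last by right.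
    by rewrite /sid mu_start nu_start mulr0 !subr0 M1.
exists (fun z => aa (2 *: set_val z)), H; split.
- by split => //; exact: comp_continuous caa.
- move=> z bz; have l2 : (1 : R) <= 2 by lra.
  have e1 : (2 : R) - 1 = 1 by lra.
  by rewrite /aa out_from_ray// e1 scale1r clipK eu.
- move=> z t bz; rewrite HU; last by constructor 1.
  rewrite U1; last by left.
  rewrite /sid mu_end nu_end mulr1 /=.
  have -> : 3 - 1 - set_val t = 2 - set_val t :> R by lra.
  exact: in_from_mid.
- move=> z; rewrite HU; last by constructor 2.
  by rewrite U0// /bot mu_end.
- move=> z; rewrite HU; last by constructor 3.
  rewrite U1; last by right.
  rewrite /sid mu_end nu_end mulr1 /=.
  have -> : 3 - 1 - 1 = 1 :> R by lra.
  by rewrite scale1r; exact: in_from_in.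
Qed.

(** The mapping path space, of the points [x] of [X] with a path in [Y] that
starts at [g x]. *)
Definition path_space : cgTop := pullback g (hom_eval Y (Some (itv0 R) : plus I)).

Definition path_end : cgMap path_space Y :=
  cg_comp (hom_eval Y (Some (itv1 R) : plus I)) (pb_snd _ _).

(** A lifting problem for [path_end] is the data of
[homotopy_extension_lifting], the paths being the tracks of the homotopy [h]. *)
Lemma path_end_acyclic : acyclic R path_end.
Proof.
move=> n u v cu cv uv.
have cus : continuous (fun s : sphere R n => u (sphere_incl s)).
  apply/continuous_subspace_setT; apply: (within_comp (A := @bd R n)) cu.
    by apply: continuous_subspaceT; exact: sphere_incl_continuous.
  by move=> s _; exact: bd_sphere_incl.
pose h (y : cylinder R n) : Y := pb_snd g _ (u y.1) (Some y.2).
have chs : continuous (fun y : sphere R n * I => h (sphere_incl y.1, y.2)).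
  apply: (@plus_uncurry (sphere R n) I Y (fun s => pb_snd g _ (u (sphere_incl s)))).
  exact: (comp_continuous cus (@cg_continuous _ _ (pb_snd _ _))).
pose inc (y : sphere R n * I) : cylinder R n := (sphere_incl y.1, y.2).
have cinc : continuous inc.
  apply: pair_continuous; last exact: snd_continuous.
  exact: (comp_continuous (@fst_continuous _ _) (@sphere_incl_continuous R n)).
have ch : {within [set x | bd x.1], continuous h}.
  have -> : [set x : cylinder R n | bd x.1] = range inc.
    apply/seteqP; split => [[z t] bz|_ [s _ <-]]; last exact: bd_sphere_incl.
    by exists (bd_point bz, t) => //; rewrite /inc bd_pointK.
  exact: (within_range (@ch_compact (prod_ch (sphere R n) I))
    (@ch_hausdorff (cylinder R n)) cinc chs).
have cu1 : {within @bd R n, continuous (fun z => pb_fst g _ (u z))}.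
  apply: (within_comp (A := setT)) cu _ _ => //.
  by apply: continuous_subspaceT; exact: cg_continuous.
have [||w [H [[cw cH] wu Hh H0 H1]]] := homotopy_extension_lifting cu1 ch cv.
- by move=> z bz; rewrite /h [RHS](pbP (u z)).
- by move=> z bz; rewrite /h /= -uv.
have [|F cF FH] := @plus_curry (disc R n) I Y (fun z t => H (z, t)).
  suff -> : (fun y : cylinder R n => H (y.1, y.2)) = H by [].
  by apply/funext => -[].
have FE z : g (w z) = hom_eval Y (Some (itv0 R) : plus I) (F z) by rewrite /= FH H0.
exists (fun z => pb_pair (FE z)); split.
- apply: pb_continuous => //.
  by apply: compact_hausdorff_k_space; [exact: ch_compact|exact: ch_hausdorff].
- move=> z bz; apply: pb_eq; first exact: wu.
  apply: cgMap_eq => -[t|] /=; last by rewrite !cg_pointed.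
  by rewrite /pb_snd_fun /= FH Hh.
- by move=> z; rewrite /= /pb_snd_fun /= FH H1.
Qed.

End homotopy_lifting.

(** * Mapping spaces out of cofibrant objects *)

Section cofibrant_objects.
Context (R : realType).

Notation D n := (disc R n).
Notation S n := (sphere R n).
Notation I := (unit_interval R).

(** Acyclic maps are trivial fibrations, so cofibrant objects have this property.
The converse inclusion of the classes of maps is avoided by proving the property
directly for the other objects that occur. *)
Definition lifts_acyclic (A : cgTop) : Prop :=
  forall (E B : cgTop) (p : cgMap E B), acyclic R p ->
  forall v : cgMap A B, exists h : cgMap A E, forall a, p (h a) = v a.

Lemma cofibrant_lifts_acyclic (A : cgTop) : cofibrant R A -> lifts_acyclic A.
Proof.
move=> cA E B p ap v.
have [|h [_ ph]] := cA E B p (acyclic_fibration ap) (acyclic_weak_equivalence ap)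
    (cst_cgMap cg_point E) v.
  by apply: cgMap_eq => a /=; rewrite !cg_pointed.
by exists h => a; rewrite -ph.
Qed.

Lemma bd0 (z : D 0) : ~ bd z.
Proof.
rewrite /bd /=; have -> : set_val z = 0 by apply/rowP => -[].
by rewrite nrm0 => /eqP; rewrite eq_sym oner_eq0.
Qed.

Lemma acyclic_surjective (E B : topologicalType) (p : E -> B) (e0 : E) :
  acyclic R p -> forall b, exists e, p e = b.
Proof.
move=> ap b; have [||z /bd0 //|w [_ _ pw]] := ap 0 (fun=> e0) (fun=> b).
- by apply: continuous_subspaceT; exact: cst_continuous.
- exact: cst_continuous.
by exists (w (clip 0)).
Qed.

Lemma lifts_acyclic_plus (P : chTop) :
  (forall (E B : cgTop) (p : cgMap E B) (v : P -> B), acyclic R p -> continuous v ->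
     exists w : P -> E, continuous w /\ forall x, p (w x) = v x) ->
  lifts_acyclic (plus P).
Proof.
move=> lP E B p ap v.
have [|w [cw pw]] := lP E B p (fun x => v (Some x)) ap.
  exact: (comp_continuous (@Some_continuous _) (@cg_continuous _ _ v)).
by exists (plus_cg cw) => -[x|] /=; rewrite ?pw// !cg_pointed.
Qed.

(** A sphere is a disc attached to the pole by its boundary. *)
Lemma sphere_lift (n : nat) (E B : cgTop) (p : cgMap E B) (v : S n -> B) :
  acyclic R p -> continuous v ->
  exists w : S n -> E, continuous w /\ forall x, p (w x) = v x.
Proof.
case: n v => [|m] v ap cv.
  exists (fun=> point); split; first exact: cst_continuous.
  by move=> s; exfalso; exact: bd0 (bd_sphere_incl s).
have [e pe] := acyclic_surjective point ap (v (pole R m)).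
have ce : {within [set pole R m], continuous (fun _ : S m.+1 => e)}.
  by apply: continuous_subspaceT; exact: cst_continuous.
have [|||x ->//|w [cw _ pw]] := acyclic_attach (phi := @collapse R m) ap
    (@ch_hausdorff (S m.+1)) (@collapse_continuous R m) _ _ _ ce cv.
- by apply: compact_closed; [exact: ch_hausdorff|exact: compact_set1].
- by move=> z; split => [/collapse_pole|/collapse_pole].
- by move=> z z' nz /collapse_inj [//|[/nz]].
have cover x : ([set pole R m] `|` range (@collapse R m)) x.
  have [->|/collapse_surj [z <-]] := pselect (x = pole R m); first by left.
  by right; exists z.
exists w; split => [|x]; last exact: pw.
apply/continuous_subspace_setT.
rewrite (_ : setT = [set pole R m] `|` range (@collapse R m)) //.
by apply/seteqP; split => // x _; exact: cover.
Qed.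

Lemma disc_lift (n : nat) (E B : cgTop) (p : cgMap E B) (v : D n -> B) :
  acyclic R p -> continuous v ->
  exists w : D n -> E, continuous w /\ forall x, p (w x) = v x.
Proof.
move=> ap cv.
have [u [cu pu]] := sphere_lift ap (comp_continuous (@sphere_incl_continuous R n) cv).
have [|z bz|w [cw _ pw]] := ap n (fun z => plus_cg cu (to_sphere z)) v _ cv.
- apply: (within_comp (A := setT)) => //; first exact: to_sphere_within.
  by apply: continuous_subspaceT; exact: (@cg_continuous _ _ (plus_cg cu)).
- by rewrite (to_sphereE bz) /= pu bd_pointK.
by exists w.
Qed.

Lemma lifts_acyclic_sphere (n : nat) : lifts_acyclic (plus (S n)).
Proof. by apply: lifts_acyclic_plus => E B p v; exact: sphere_lift. Qed.

Lemma lifts_acyclic_disc (n : nat) : lifts_acyclic (plus (D n)).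
Proof. by apply: lifts_acyclic_plus => E B p v; exact: disc_lift. Qed.

Lemma lifts_acyclic_cylinder (n : nat) : lifts_acyclic (plus (cylinder R n)).
Proof.
apply: lifts_acyclic_plus => E B p v ap cv.
have [u [cu pu]] := disc_lift ap (cylinder_end_continuous (t := itv0 R) cv).
have [w [cw _ pw]] := acyclic_cylinder ap cu cv pu.
by exists w.
Qed.

Section corner_map.
Context (n : nat) (E B : cgTop) (p : cgMap E B).

Let i : cgMap (plus (S n)) (plus (D n)) := plus_map (@sphere_incl_continuous R n).

Definition corner : cgTop := pullback (Hom_map (plus (S n)) p) (hom_pre B i).

Lemma corner_subproof (w : Hom (plus (D n)) E) :
  Hom_map (plus (S n)) p (hom_pre E i w) = hom_pre B i (Hom_map (plus (D n)) p w).
Proof. exact: cgMap_eq. Qed.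

Definition corner_map : cgMap (Hom (plus (D n)) E) corner := pb_lift corner_subproof.

(** A lifting problem for the corner map is one for [p] on [D^l * D^n] relative
to its boundary, and [D^l * D^n] is a disc. *)
Lemma corner_map_acyclic : acyclic R p -> acyclic R corner_map.
Proof.
move=> ap l u v cu cv uv.
have cv1 : continuous (fun y : D l * S n => pb_fst _ _ (v y.1) (Some y.2)).
  apply: (@plus_uncurry (D l) (S n) E (fun z => pb_fst _ _ (v z))).
  exact: (comp_continuous cv (@cg_continuous _ _ (pb_fst _ _))).
have cv2 : continuous (fun y : D l * D n => pb_snd _ _ (v y.1) (Some y.2)).
  apply: (@plus_uncurry (D l) (D n) B (fun z => pb_snd _ _ (v z))).
  exact: (comp_continuous cv (@cg_continuous _ _ (pb_snd _ _))).
have cu1 : continuous (fun y : S l * D n => u (sphere_incl y.1) (Some y.2)).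
  apply: (@plus_uncurry (S l) (D n) E (fun s => u (sphere_incl s))).
  apply/continuous_subspace_setT; apply: (within_comp (A := @bd R l)) cu.
    by apply: continuous_subspaceT; exact: sphere_incl_continuous.
  by move=> s _; exact: bd_sphere_incl.
pose f1 (y : D l * D n) : E := u y.1 (Some y.2).
pose f2 (y : D l * D n) : E := pb_fst _ _ (v y.1) (to_sphere y.2).
pose U y := if pselect (bd y.1) then f1 y else f2 y.
have U1 y : bd y.1 -> U y = f1 y by rewrite /U; case: pselect.
have U2 y : bd y.2 -> U y = f2 y.
  move=> b2; rewrite /U; case: pselect => // b1; rewrite /f1 /f2 -uv//.
  by rewrite (to_sphereE b2) /= /pb_fst_fun /= bd_pointK.
have cU1 : {within [set y : D l * D n | bd y.1], continuous f1}.
  pose inc (y : S l * D n) : D l * D n := (sphere_incl y.1, y.2).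
  have -> : [set y : D l * D n | bd y.1] = range inc.
    apply/seteqP; split => [[z t] bz|_ [s _ <-]]; last exact: bd_sphere_incl.
    by exists (bd_point bz, t) => //; rewrite /inc bd_pointK.
  apply: (@within_range _ _ _ inc f1 (@ch_compact (prod_ch (S l) (D n)))
    (@ch_hausdorff (prod_ch (D l) (D n))) _ cu1).
  apply: pair_continuous; last exact: snd_continuous.
  exact: (comp_continuous (@fst_continuous _ _) (@sphere_incl_continuous R l)).
have cU2 : {within [set y : D l * D n | bd y.2], continuous f2}.
  pose inc (y : D l * S n) : D l * D n := (y.1, sphere_incl y.2).
  have -> : [set y : D l * D n | bd y.2] = range inc.
    apply/seteqP; split => [[z t] bz|_ [s _ <-]]; last exact: bd_sphere_incl.
    by exists (z, bd_point bz) => //; rewrite /inc bd_pointK.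
  apply: (@within_range _ _ _ inc f2 (@ch_compact (prod_ch (D l) (S n)))
    (@ch_hausdorff (prod_ch (D l) (D n)))).
    apply: pair_continuous; first exact: fst_continuous.
    exact: (comp_continuous (@snd_continuous _ _) (@sphere_incl_continuous R n)).
  suff -> : (fun y => f2 (inc y)) =
      (fun y : D l * S n => pb_fst _ _ (v y.1) (Some y.2)) by [].
  by apply/funext => y; rewrite /f2 /inc /= to_sphere_incl.
have cU : {within @prod_bd R l n, continuous U}.
  rewrite (_ : @prod_bd R l n = [set y : D l * D n | bd y.1] `|` [set y | bd y.2]) //.
  apply: withinU_continuous.
  - have /continuous_closedP := @fst_continuous (D l) (D n).
    by move=> /(_ _ (@bd_closed R l)).
  - have /continuous_closedP := @snd_continuous (D l) (D n).
    by move=> /(_ _ (@bd_closed R n)).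
  - by apply: within_eq cU1 _ => y /= /U1.
  - by apply: within_eq cU2 _ => y /= /U2.
have [|W [cW WU pW]] := acyclic_pair ap (@prod_disc_pair R l n) cU cv2.
  move=> [z y] [b|b]; first by rewrite U1//= -uv.
  rewrite U2// /f2 /= (to_sphereE b).
  have := congr1 (fun h : cgMap (plus (S n)) B => h (Some (bd_point b))) (pbP (v z)).
  by rewrite /= bd_pointK.
have [|w cw wW] := @plus_curry (D l) (D n) E (fun z y => W (z, y)).
  suff -> : (fun y : D l * D n => W (y.1, y.2)) = W by [].
  by apply/funext => -[].
exists w; split => // z.
- move=> bz; apply: cgMap_eq => -[y|]; last by rewrite !cg_pointed.
  by rewrite wW WU ?U1//; left.
- apply: pb_eq; apply: cgMap_eq => -[y|].
  + rewrite /= /pb_fst_fun /= wW WU; last by right; exact: bd_sphere_incl.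
    by rewrite U2 ?/f2 /= ?to_sphere_incl//; exact: bd_sphere_incl.
  + by rewrite !cg_pointed.
  + by rewrite /= /pb_snd_fun /= wW pW.
  + by rewrite !cg_pointed.
Qed.

End corner_map.

(** A lifting problem for [Hom(A, p)] on a disc is a lifting problem for the
corner map on [A]. *)
Lemma hom_acyclic (A E B : cgTop) (p : cgMap E B) :
  lifts_acyclic A -> acyclic R p -> acyclic R (Hom_map A p).
Proof.
move=> lA ap n u v cu cv uv.
have cus : continuous (fun s : S n => u (sphere_incl s)).
  apply/continuous_subspace_setT; apply: (within_comp (A := @bd R n)) cu.
    by apply: continuous_subspaceT; exact: sphere_incl_continuous.
  by move=> s _; exact: bd_sphere_incl.
pose a1 := swap (plus_cg cus); pose a2 := swap (plus_cg cv).
have a12 a : Hom_map (plus (S n)) p (a1 a) =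
             hom_pre B (plus_map (@sphere_incl_continuous R n)) (a2 a).
  apply: cgMap_eq => -[s|] /=; last by rewrite cg_pointed.
  by rewrite -uv//; exact: bd_sphere_incl.
have [h ph] := lA _ _ _ (corner_map_acyclic (n := n) ap) (pb_lift a12).
exists (fun z => swap h (Some z)); split.
- exact: (comp_continuous (@Some_continuous _) (@cg_continuous _ _ (swap h))).
- move=> z bz; apply: cgMap_eq => a /=.
  have := congr1 (fun y : corner n p =>
    hom_eval E (Some (bd_point bz) : plus (S n)) (pb_fst _ _ y)) (ph a).
  by rewrite /= /pb_fst_fun /= bd_pointK.
- move=> z; apply: cgMap_eq => a /=.
  exact: (congr1 (fun y : corner n p =>
    hom_eval B (Some z : plus (D n)) (pb_snd _ _ y)) (ph a)).
Qed.

(** A map out of [A /\ B] is a map from [A] to [Hom(B, -)]. *)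
Lemma lifts_acyclic_smash (A B : cgTop) :
  lifts_acyclic A -> lifts_acyclic B -> lifts_acyclic (smash A B).
Proof.
move=> lA lB E Z p ap v.
have [h ph] := lA _ _ _ (hom_acyclic lB ap) (smash_curry v).
exists (smash_uncurry h) => s /=.
have := congr1 (fun f : cgMap B Z => f (repr s).2) (ph (repr s).1) => /= ->.
by rewrite -surjective_pairing smash_repr.
Qed.

Section constant_paths.
Context (P : chTop) (Y : cgTop).

Definition constant_fun (y : Y) : Hom (plus P) Y :=
  plus_cg (@cst_continuous P Y y).

Lemma constant_fun_continuous : continuous constant_fun.
Proof.
by apply: hom_plus_continuousP; [exact: cg_k_space|move=> C s h [_ _ cs] _].
Qed.

Lemma constant_fun_pointed : constant_fun point = point.
Proof. by apply: cgMap_eq => -[]. Qed.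

Definition constant_map : cgMap Y (Hom (plus P) Y) :=
  CGMap constant_fun_continuous constant_fun_pointed.
End constant_paths.

(** [Hom(A, -)] keeps the end map of the path space acyclic, and it keeps the
retraction of the path space onto [X] and the homotopy that goes along the paths. *)
Lemma hom_weak_equivalence (A X Y : cgTop) (g : cgMap X Y) :
  lifts_acyclic A -> weak_equivalence R g -> weak_equivalence R (Hom_map A g).
Proof.
move=> lA we.
pose N := path_space R g.
have jE x : g (cg_id X x) =
    hom_eval Y (Some (itv0 R) : plus I) (cg_comp (constant_map I Y) g x) by [].
pose j : cgMap X N := pb_lift jE.
pose q : cgMap N (Hom (plus I) Y) := pb_snd _ _.
pose th (n : Hom A N) (t : I) : Hom A Y := hom_swap A (plus I) Y (Hom_map A q n) (Some t).
apply: (@weak_equivalence_factor R _ (Hom A N) _ _ (Hom_map A (path_end R g))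
  (Hom_map A j) (Hom_map A (pb_fst _ _)) th).
- by apply: hom_acyclic => //; exact: path_end_acyclic.
- by move=> x; exact: cgMap_eq.
- by move=> x; exact: cgMap_eq.
- by move=> n; apply: cgMap_eq => a /=; rewrite [RHS](pbP (n a)).
- by move=> n; exact: cgMap_eq.
- by move=> x t; exact: cgMap_eq.
- move=> C s t [cC hC cs] [_ _ ct].
  apply: (@eval_test_continuous C (plus I) (Hom A Y)
    (fun c => hom_swap A (plus I) Y (Hom_map A q (s c))) (fun c => Some (t c))) => //.
  + apply: (comp_continuous _ (@cg_continuous _ _ (hom_swap A (plus I) Y))).
    exact: (comp_continuous cs (@cg_continuous _ _ (Hom_map A q))).
  + exact: (comp_continuous ct (@Some_continuous _)).
Qed.

Lemma rel_homotopic_comp (X Y : topologicalType) (f : X -> Y) (n : nat) (a b : D n -> X) :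
  continuous f -> rel_homotopic a b ->
  rel_homotopic (fun z => f (a z)) (fun z => f (b z)).
Proof.
move=> cf [H [cH H0 H1 Hs]]; exists (fun y => f (H y)); split.
- exact: comp_continuous.
- by move=> z; rewrite H0.
- by move=> z; rewrite H1.
- by move=> s t; rewrite Hs.
Qed.

Lemma spheroid_comp (X Y : topologicalType) (f : X -> Y) (n : nat) (x : X) (a : D n -> X) :
  continuous f -> spheroid x a -> spheroid (f x) (fun z => f (a z)).
Proof.
by move=> cf [ca ax]; split => [|s]; [exact: comp_continuous|rewrite ax].
Qed.

Lemma weak_equivalence_iso (X Y X' Y' : cgTop) (f : cgMap X Y) (f' : cgMap X' Y')
    (i : cgMap X' X) (i' : cgMap X X') (k : cgMap Y' Y) (k' : cgMap Y Y') :
  cancel i i' -> cancel i' i -> cancel k k' -> (forall x, k (f' x) = f (i x)) ->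
  weak_equivalence R f -> weak_equivalence R f'.
Proof.
move=> iK i'K kK kf we n x; have [wes wei] := we n (i x).
have ck := @cg_continuous _ _ k; have ck' := @cg_continuous _ _ k'.
have ci := @cg_continuous _ _ i; have ci' := @cg_continuous _ _ i'.
split.
- move=> b /(spheroid_comp ck); rewrite kf => /wes [a /(spheroid_comp ci') sa ab].
  rewrite iK in sa; exists (fun z => i' (a z)) => //.
  have := rel_homotopic_comp ck' ab.
  congr (rel_homotopic _ _); apply/funext => z /=; last by rewrite kK.
  by rewrite -(kK (f' _)) kf i'K.
- move=> a a' sa sa' aa'.
  have /(rel_homotopic_comp ci') : rel_homotopic (fun z => i (a z)) (fun z => i (a' z)).
    apply: wei; [exact: spheroid_comp sa|exact: spheroid_comp sa'|].
    have := rel_homotopic_comp ck aa'.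
    by congr (rel_homotopic _ _); apply/funext => z /=; rewrite kf.
  by congr (rel_homotopic _ _); apply/funext => z /=; rewrite iK.
Qed.

Lemma hom_colocal_equivalence (Ix : Type) (K : Ix -> cgTop) (C X Y : cgTop)
    (f : cgMap X Y) :
  lifts_acyclic C -> colocal_equivalence R K f -> colocal_equivalence R K (Hom_map C f).
Proof.
move=> lC Kf i.
apply: (@weak_equivalence_iso _ _ _ _ (Hom_map C (Hom_map (K i) f)) _
  (hom_swap (K i) C X) (hom_swap C (K i) X) (hom_swap (K i) C Y) (hom_swap C (K i) Y)).
- exact: hom_swapK.
- exact: hom_swapK.
- exact: hom_swapK.
- by move=> F; exact: hom_swap_natural.
- by apply: hom_weak_equivalence => //; exact: Kf.
Qed.

End cofibrant_objects.

Theorem theorem9p2 (R : realType) (I : Type) (K : I -> cgTop)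
    (K_cofibrant : forall i, cofibrant R (K i))
    (K_small : forall i, small_wrt (@cofibration R) (K i)) :
  condition_dollar R K.
Proof.
move=> A B m Lm C CAB X Y f _ _; apply: hom_colocal_equivalence.
have lK i := cofibrant_lifts_acyclic (K_cofibrant i).
case: Lm C CAB => [[i n]|[n]] C [->|->].
- by apply: lifts_acyclic_smash => //; exact: lifts_acyclic_sphere.
- by apply: lifts_acyclic_smash => //; exact: lifts_acyclic_disc.
- exact: lifts_acyclic_disc.
- exact: lifts_acyclic_cylinder.
Qed.
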